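(* Let $E:\mathbb{R}^{n+j}_{+}\to\mathbb{R}$ be the error model objective $$E(v)=\left(\int_{\mathcal{X}}w(p)^q\,\epsilon_v(p)^q\,dp\right)^{1/q}$$ defined in the context, in terms of the Gaussian process posterior standard deviation $\sigma_v$ for evaluation points $p_1,\dots,p_{n+j}$ with evaluation error variances $v_i^{-1}$. If $2\le q<\infty$, then $E$ is convex in $v$. If, in addition, the covariance kernel is strictly positive, then $E$ is strictly convex, and for any minimizer $v$ of the problem $$\min_{v\in\mathbb{R}^{n+j}_+}E(v)\quad\text{s.t.}\quad W(v)\le\Delta W+W(\mathcal{D}),\quad v\ge\underline{v},$$ the work constraint is active, i.e. $W(v)=\Delta W+W(\mathcal{D})$.
   Context: $\mathcal{X}\subset\mathbb{R}^d$ is closed and bounded (with positive Lebesgue measure), and $\mathbb{R}_+=[0,\infty)$. A current design $\mathcal{D}$ consists of distinct evaluation points $p_1,\dots,p_n\in\mathcal{X}$ with evaluation tolerances $\epsilon_1,\dots,\epsilon_n\in(0,\infty)$; additionally there are $j$ distinct candidate points $p_{n+1},\dots,p_{n+j}\in\mathcal{X}\setminus\{p_1,\dots,p_n\}$. The design variable is $v=(v_1,\dots,v_{n+j})$, $v_i=\epsilon_i^{-2}\ge0$, where $v_i=0$ means no evaluation at $p_i$. Covariance and posterior variance. Let $k:\mathbb{R}^d\times\mathbb{R}^d\to\mathbb{R}$ be a continuous, symmetric, translation-invariant ($k(p+a,p'+a)=k(p,p')$) positive definite covariance kernel. It is called strictly positive if $k(p,p')>0$ for all $p,p'$. For $p\in\mathcal{X}$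 let $K(p)\in\mathbb{R}^{(n+j+1)\times(n+j+1)}$ be the covariance matrix with entries $k(x_a,x_b)$ for $(x_1,\dots,x_{n+j+1})=(p_1,\dots,p_{n+j},p)$, and let $V=\mathrm{diag}(v_1,\dots,v_{n+j},0)$. The posterior variance at $p$ is $$\sigma_v^2(p)=e_{n+j+1}^T\left[K(p)^{-1}+V\right]^{-1}e_{n+j+1},$$ with $[K^{-1}+V]^{-1}$ read as $(I+KV)^{-1}K$ when $K$ is singular (e.g. when $p$ is one of the $p_i$); $e_i$ is the $i$-th unit vector. For model outputs in $\mathbb{R}^m$ with independent components, each component is treated separately in this way with its own continuous, symmetric, translation-invariant positive definite covariance kernel $\mathbb{R}^d\times\mathbb{R}^d\to\mathbb{R}$ (all assumed strictly positive when ''the kernel'' is), with the same $v$, and $\sigma_v(p)$ denotes the $m\times m$ diagonal matrix of the component standard deviations (for $m=1$ a scalar). Error model. $\epsilon_v(p)^q$ is one of the two expressions $$\epsilon_v(p)^q=\left(m\left(1-\tfrac{2}{9m}\right)^3\right)^{q/2}\|\sigma_v(p)\|_2^q\quad\text{or}\quad\epsilon_v(p)^q=\mathrm{tr}\left(\sigma_v(p)^q\right),$$ where $\|\cdot\|_2$ is the spectral norm; the statement is for either choice. The weight $w:\mathcal{X}\to(0,\infty)$ is a fixed, bounded measurable function not depending on $v$; in the paper $w(p)=(1+\alpha e_0(p))^{-1}\left(12L^{-1}\|\Sigma_l^{-1}\|C_1+\beta C_2^{-1}\right)$ with positive quantities $L,C_1,C_2,e_0$ (possibly depending on $p$), $\alpha,\beta\ge0$,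 and measurement covariance $\Sigma_l$, or an estimate of this expression. Work model. For a fixed exponent $s>0$, $W(v)=\sum_{i=1}^{n+j}v_i^s$ and $W(\mathcal{D})=\sum_{i=1}^n\epsilon_i^{-2s}$; $\Delta W>0$ is the incremental budget. The lower bound is $\underline{v}=(\epsilon_1^{-2},\dots,\epsilon_n^{-2},0,\dots,0)\in\mathbb{R}^{n+j}$, and $v\ge\underline{v}$ is understood componentwise.
   Formalization: Strict convexity is stated under the added hypothesis that X meets every neighbourhood of each evaluation point p_i in positive Lebesgue measure; without it strict convexity can fail (e.g. isolated evaluation points). *)

(* Defs.v *)
From HB Require Import structures.
From mathcomp Require Import all_boot all_order all_algebra.
From mathcomp Require Import all_classical all_reals all_analysis.

Set Implicit Arguments.
Unset Strict Implicit.
Unset Printing Implicit Defensive.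

Import Order.TTheory GRing.Theory Num.Theory.
Import numFieldNormedType.Exports.

Local Open Scope classical_set_scope.
Local Open Scope ring_scope.

(** * Lebesgue measure on R^d *)

Definition measure_rV_display : measure_display -> measure_display.
Proof. exact. Qed.

Section measurable_rV.
Context {dp : measure_display} {T : measurableType dp}.
Variable d : nat.

Let coors : 'I_d -> 'rV[T]_d -> T := fun i x => x ord0 i.

Let rV_set0 : g_sigma_preimage coors set0.
Proof. exact: sigma_algebra0. Qed.

Let rV_setC A : g_sigma_preimage coors A -> g_sigma_preimage coors (~` A).
Proof. exact: sigma_algebraC. Qed.

Let rV_bigcup (F : _^nat) : (forall i, g_sigma_preimage coors (F i)) ->
  g_sigma_preimage coors (\bigcup_i (F i)).
Proof. exact: sigma_algebra_bigcup. Qed.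

(* The sigma-algebra generated by the coordinates; over R it is the Borel
   sigma-algebra, as R is second countable. *)
HB.instance Definition _ := @isMeasurable.Build (measure_rV_display dp)
  'rV[T]_d (g_sigma_preimage coors) rV_set0 rV_setC rV_bigcup.

End measurable_rV.

Lemma measurable_rV_coor dp (T : measurableType dp) d (i : 'I_d) :
  measurable_fun [set: 'rV[T]_d] (fun x : 'rV[T]_d => x ord0 i).
Proof.
move=> _ Y mY; rewrite setTI; apply: sub_sigma_algebra => /=.
rewrite -bigcup_seq/=; exists i => /=; first by rewrite mem_index_enum.
by exists Y => //; rewrite setTI.
Qed.

Lemma measurable_fun_rV dp (T : measurableType dp) dp' (S : measurableType dp')
    d (f : S -> 'rV[T]_d) :
  (forall i, measurable_fun setT (fun s => f s ord0 i)) ->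
  measurable_fun setT f.
Proof.
move=> mf.
have fS : g_sigma_preimage (fun (i : 'I_d) s => f s ord0 i) `<=` measurable.
  apply: smallest_sub; first exact: sigma_algebra_measurable.
  by move=> A; rewrite -bigcup_seq => -[i _] [B mB <-]; exact: mf.
move=> _ A mA; apply: fS.
have := @g_sigma_preimage_comp _ T d _ (fun i (x : 'rV[T]_d) => x ord0 i) _ f.
by rewrite /comp => ->; exists A.
Qed.

Section lebesgue_rV.
Variable R : realType.

(* (x, a) |-> (a, x_1, ..., x_d) *)
Definition rV_cons d (xa : 'rV[R]_d * R) : 'rV[R]_d.+1 :=
  row_mx (const_mx xa.2 : 'rV[R]_1) xa.1.

Lemma measurable_rV_cons d : measurable_fun setT (@rV_cons d).
Proof.
apply: measurable_fun_rV => i.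
case: (@split_ordP 1 d i) => [j ->|j ->].
  rewrite (_ : (fun _ => _) = snd); first exact: measurable_snd.
  by apply/funext => xa; rewrite /rV_cons (@row_mxEl _ _ 1 d) mxE.
rewrite (_ : (fun _ => _) = (fun x : 'rV[R]_d => x ord0 j) \o fst).
  by apply: measurableT_comp => //; exact: measurable_rV_coor.
by apply/funext => xa; rewrite /rV_cons (@row_mxEr _ _ 1 d).
Qed.

Section lebesgue_rV_step.
Local Open Scope ereal_scope.
Variables (d : nat) (mu : {measure set 'rV[R]_d -> \bar R}).

Definition rV_cons_measure : set 'rV[R]_d.+1 -> \bar R :=
  pushforward (mu \x @lebesgue_measure R) (@rV_cons d).

Let pre A : measurable A -> measurable (@rV_cons d @^-1` A).
Proof.
move=> mA; rewrite -[X in measurable X]setTI.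
exact: (@measurable_rV_cons d).
Qed.

Let rV_cons_measure0 : rV_cons_measure set0 = 0.
Proof. by rewrite /rV_cons_measure /pushforward preimage_set0 measure0. Qed.

Let rV_cons_measure_ge0 A : 0 <= rV_cons_measure A.
Proof. by apply: integral_ge0 => x _; exact: measure_ge0. Qed.

Let rV_cons_measure_sigma_additive : semi_sigma_additive rV_cons_measure.
Proof.
move=> F mF tF mUF; rewrite /rV_cons_measure /pushforward preimage_bigcup.
apply: measure_semi_sigma_additive => [n||].
- exact: pre.
- apply/trivIsetP => /= i j _ _ ij; rewrite -preimage_setI.
  by move/trivIsetP : tF => /(_ _ _ _ _ ij) ->//; rewrite preimage_set0.
- by rewrite -preimage_bigcup; exact: pre.
Qed.

HB.instance Definition _ := isMeasure.Build _ _ _ rV_cons_measure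
  rV_cons_measure0 rV_cons_measure_ge0 rV_cons_measure_sigma_additive.

End lebesgue_rV_step.

Fixpoint lebesgue_rV d : {measure set 'rV[R]_d -> \bar R} :=
  if d is d'.+1 then rV_cons_measure (lebesgue_rV d')
  else dirac (0 : 'rV[R]_0).

Lemma lebesgue_rV_box d (A : 'I_d -> set R) :
  (forall i, measurable (A i)) ->
  (lebesgue_rV d [set x | forall i, A i (x ord0 i)] =
   \prod_(i < d) lebesgue_measure (A i))%E.
Proof.
elim: d A => [|d IHd] A mA.
  by rewrite big_ord0 /= diracE mem_set// => -[].
have mB : measurable [set x : 'rV[R]_d | forall i, A (lift ord0 i) (x ord0 i)].
  rewrite (_ : mkset _ = \bigcap_(i in [set: 'I_d])
      ((fun x : 'rV[R]_d => x ord0 i) @^-1` A (lift ord0 i))); last first.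
    by apply/seteqP; split => [x Ax i _|x Ax i]; exact: Ax.
  apply: fin_bigcap_measurable => // i _.
  by rewrite -[X in measurable X]setTI; exact: measurable_rV_coor.
rewrite big_ord_recl muleC /= /rV_cons_measure /pushforward.
rewrite -IHd; last by move=> i; exact: mA.
apply: etrans (product_measure1E (lebesgue_rV d) (@lebesgue_measure R)
  mB (mA ord0)).
congr (_ _); apply/seteqP; split => [[x a] /= Axa|[x a] /= [Ax Aa] i].
  split => [i|].
    by have := Axa (lift ord0 i); rewrite -(rshift1 i) /rV_cons (@row_mxEr _ _ 1 d).
  have := Axa (@lshift 1 d ord0); rewrite /rV_cons (@row_mxEl _ _ 1 d) mxE/=.
  by congr (A _ _); apply/val_inj.
case: (@split_ordP 1 d i) => [j ->|j ->].
  rewrite /rV_cons (@row_mxEl _ _ 1 d) mxE/= ord1.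
  by rewrite (_ : @lshift 1 d ord0 = ord0)//; exact/val_inj.
by rewrite /rV_cons (@row_mxEr _ _ 1 d) rshift1; exact: Ax.
Qed.

End lebesgue_rV.

Arguments lebesgue_rV {R} d.

(** * Convexity and matrix norms *)

Section strict_convexity.
Local Open Scope convex_scope.

Definition strictly_convex_function (R : numFieldType) (E : lmodType R)
    (E' := convex_lmodType E) (D : set E') (f : E' -> R^o) :=
  forall t : {i01 R}, 0 < t%:num < 1 ->
    {in D &, forall x y : E',
      x != y -> (f (x <| t |> y) < f x <| t |> f y)%R}.

End strict_convexity.

Section matrices.
Variable R : realType.

Definition l2norm n (x : 'cV[R]_n) : R := Num.sqrt (\sum_i x i ord0 ^+ 2).

Definition spectral_norm m n (A : 'M[R]_(m, n)) : R :=
  sup [set l2norm (A *m x) | x in [set x : 'cV[R]_n | l2norm x <= 1]].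

(* A ^ q for a diagonal matrix A with nonnegative diagonal entries *)
Definition diag_mx_powR m (A : 'M[R]_m) (q : R) : 'M[R]_m :=
  diag_mx (\row_i (A i i `^ q)).

End matrices.

(** * Covariance kernels and posterior variance *)

Section posterior.
Variables (R : realType) (d : nat).

(* Positive definiteness is strict: Gram matrices at pairwise distinct points
   are positive definite. *)
Definition positive_definite_kernel (k : 'rV[R]_d -> 'rV[R]_d -> R) :=
  forall (N : nat) (x : 'I_N -> 'rV[R]_d) (c : 'I_N -> R),
    injective x -> (exists a, c a != 0) ->
    0 < \sum_a \sum_b c a * c b * k (x a) (x b).

Definition covariance_kernel (k : 'rV[R]_d -> 'rV[R]_d -> R) :=
  [/\ continuous (fun z : 'rV[R]_d * 'rV[R]_d => k z.1 z.2),
      forall p p', k p p' = k p' p,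
      forall a p p', k (p + a) (p' + a) = k p p' &
      positive_definite_kernel k].

Definition strictly_positive_kernel (k : 'rV[R]_d -> 'rV[R]_d -> R) :=
  forall p p', 0 < k p p'.

Variable N : nat.

(* (p_1, ..., p_N, p) *)
Definition augmented_points (P : 'I_N -> 'rV[R]_d) (p : 'rV[R]_d)
    (a : 'I_(N + 1)) : 'rV[R]_d :=
  match fintype.split a with inl i => P i | inr _ => p end.

Definition covariance_mx k (P : 'I_N -> 'rV[R]_d) (p : 'rV[R]_d) :
    'M[R]_(N + 1) :=
  \matrix_(a, b) k (augmented_points P p a) (augmented_points P p b).

Definition precision_mx (v : 'rV[R]_N) : 'M[R]_(N + 1) :=
  diag_mx (row_mx v 0).

(* (K^-1 + V)^-1, extended to singular K *)
Definition posterior_covariance_mx n (K V : 'M[R]_n) : 'M[R]_n :=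
  if K \in unitmx then invmx (invmx K + V) else invmx (1%:M + K *m V) *m K.

Definition posterior_variance k P (v : 'rV[R]_N) (p : 'rV[R]_d) : R :=
  let e : 'cV[R]_(N + 1) := delta_mx (rshift N ord0) ord0 in
  (e^T *m posterior_covariance_mx (covariance_mx k P p) (precision_mx v) *m e)
    ord0 ord0.

(* sigma_v(p), for m independent components with kernels k_1, ..., k_m *)
Definition posterior_sd_mx m (k : 'I_m -> 'rV[R]_d -> 'rV[R]_d -> R) P
    (v : 'rV[R]_N) (p : 'rV[R]_d) : 'M[R]_m :=
  diag_mx (\row_l Num.sqrt (posterior_variance (k l) P v p)).

End posterior.

(** * Error and work models *)

Variant error_model := SpectralModel | TraceModel.

Section objective.
Variables (R : realType) (d : nat).

(* epsilon_v(p) ^ q as a function of sigma = sigma_v(p) *)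
Definition error_pow (em : error_model) (q : R) m (sigma : 'M[R]_m) : R :=
  match em with
  | SpectralModel =>
      (m%:R * (1 - 2 / (9 * m%:R)) ^+ 3) `^ (q / 2) * spectral_norm sigma `^ q
  | TraceModel => \tr (diag_mx_powR sigma q)
  end.

Definition error_objective em (X : set 'rV[R]_d) (w : 'rV[R]_d -> R) (q : R)
    m (k : 'I_m -> 'rV[R]_d -> 'rV[R]_d -> R) N (P : 'I_N -> 'rV[R]_d)
    (v : 'rV[R]_N) : R :=
  (\int[lebesgue_rV d]_(p in X)
     (w p `^ q * error_pow em q (posterior_sd_mx k P v p))) `^ q^-1.

Definition work N (s : R) (v : 'rV[R]_N) : R := \sum_i v ord0 i `^ s.

Definition design_work n (s : R) (eps : 'I_n -> R) : R :=
  \sum_i eps i `^ (- (2 * s)).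

Definition lower_bound n j (eps : 'I_n -> R) : 'rV[R]_(n + j) :=
  row_mx (\row_i eps i ^- 2) 0.

Definition nonneg_orthant N : set 'rV[R]_N :=
  [set v | forall i, 0 <= v ord0 i].

Definition feasible n j (s dW : R) (eps : 'I_n -> R) : set 'rV[R]_(n + j) :=
  [set v | [/\ nonneg_orthant v,
               work s v <= dW + design_work s eps &
               forall i, lower_bound j eps ord0 i <= v ord0 i]].

Definition is_minimizer (T : Type) (F : set T) (f : T -> R) (v : T) :=
  F v /\ forall u, F u -> f v <= f u.

(* p is in the support of Lebesgue measure restricted to X. If X has positive
   measure but some evaluation points are, say, isolated in X, strict convexity
   can fail even for strictly positive kernels. *)
Definition in_lebesgue_support (X : set 'rV[R]_d) (p : 'rV[R]_d) :=
  forall U : set 'rV[R]_d, open U -> U p -> (0 < lebesgue_rV d (X `&` U))%E.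

End objective.

(* Main.v *)
(* With K0 the Gram matrix of the evaluation points, kappa := k(P, p) and
   M_v := K0 + K0 diag(v) K0, the posterior variance is
     sigma_v^2(p) = k(p, p) - kappa^T K0^-1 kappa + kappa^T M_v^-1 kappa.
   As M_v is affine in v, Cauchy-Schwarz and the weighted AM-GM inequality show
   that sigma_v^2(p) is log-convex in v. Log-convexity is stable under positive
   powers, sums, maxima and, by the argument of Hoelder's inequality, weighted
   integrals, so E is log-convex, hence convex. If v1 and v2 differ in the i-th
   coordinate, log-convexity is strict at p = P i, hence by continuity on a
   neighbourhood of P i, which meets X in positive measure.
   For a strictly positive kernel kappa <> 0, so increasing all the v_i strictly
   decreases sigma_v^2(p) at every p: a feasible point with budget left is not a
   minimizer. *)
Require Import Defs.
From HB Require Import structures.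
From mathcomp Require Import all_boot all_order all_algebra.
From mathcomp Require Import all_classical all_reals all_analysis.
From mathcomp Require Import measurable_realfun ring lra.

Set Implicit Arguments.
Unset Strict Implicit.
Unset Printing Implicit Defensive.

Import Order.TTheory GRing.Theory Num.Theory.
Import numFieldNormedType.Exports.

Local Open Scope classical_set_scope.
Local Open Scope ring_scope.

(** * Powers, weighted means and continuity *)

Lemma lt_powR_gt0 (R : realType) (r x y : R) :
  0 < r -> 0 < x -> x < y -> x `^ r < y `^ r.
Proof.
move=> r0 x0 xy; apply: gt0_ltr_powR; rewrite ?nnegrE ?(ltW x0)//.
exact: ltW (lt_trans x0 xy).
Qed.

Lemma le_powR_gt0 (R : realType) (r x y : R) :
  0 < r -> 0 < x -> x <= y -> x `^ r <= y `^ r.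
Proof.
move=> r0 x0; rewrite le_eqVlt => /predU1P[->//|xy].
by rewrite ltW// lt_powR_gt0.
Qed.

Lemma continuous_add (R : realType) (T : topologicalType) (f g : T -> R) :
  continuous f -> continuous g -> continuous (fun p => f p + g p).
Proof.
by move=> cf cg p; apply: (@continuousD _ _ _ f g); [exact: cf|exact: cg].
Qed.

Lemma continuous_mul (R : realType) (T : topologicalType) (f g : T -> R) :
  continuous f -> continuous g -> continuous (fun p => f p * g p).
Proof.
by move=> cf cg p; apply: (@continuousM _ _ f g); [exact: cf|exact: cg].
Qed.

Lemma continuous_sum (R : realType) (T : topologicalType) (I : finType)
    (F : I -> T -> R) :
  (forall i, continuous (F i)) -> continuous (fun p => \sum_i F i p).
Proof.
move=> cF p; rewrite (_ : (fun _ => _) = \sum_i F i); last by rewrite fct_sumE.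
apply: (@big_ind (T -> R) (fun f => {for p, continuous f})).
- by apply: cvg_cst.
- by move=> f g; exact: continuousD.
- by move=> i _; exact: cF.
Qed.

Lemma continuous_bigmax (R : realType) (T : topologicalType) (I : Type)
    (r : seq I) (x : R) (F : I -> T -> R) :
  (forall i, continuous (F i)) ->
  continuous (fun p => \big[Num.max/x]_(i <- r) F i p).
Proof.
move=> cF p; elim: r => [|i r IHr].
  rewrite (_ : (fun _ => _) = cst x); first by apply: cvg_cst.
  by apply/funext => ?; rewrite big_nil.
rewrite (_ : (fun _ => _) =
    F i \max (fun p => \big[Num.max/x]_(i <- r) F i p)).
  by apply: continuous_max => //; exact: cF.
by apply/funext => ?; rewrite big_cons.
Qed.

Lemma continuous_powR_comp (R : realType) (T : topologicalType) (f : T -> R)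
    (r : R) :
  continuous f -> (forall p, 0 < f p) -> continuous (fun p => f p `^ r).
Proof.
move=> cf f0; rewrite (_ : (fun _ => _) = (fun p => expR (r * ln (f p)))).
  move=> p; apply: continuous_comp; last exact: continuous_expR.
  apply: (@continuousM _ _ (cst r)); first by apply: cvg_cst.
  by apply: continuous_comp; [exact: cf|exact: continuous_ln].
by apply/funext => p; rewrite /powR gt_eqF.
Qed.

(** * Weighted geometric means and the weighted AM-GM inequality *)

Section geometric_mean.
Variable R : realType.
Implicit Types t a b c d : R.

(** Log-convexity of a positive function along a segment is stated as a bound of its value by
    [gmean t] of the end values, which avoids logarithms. *)
Definition gmean t a b : R := a `^ t * b `^ (1 - t).

Lemma gmean_gt0 t a b : 0 < a -> 0 < b -> 0 < gmean t a b.
Proof. by move=> a0 b0; rewrite mulr_gt0 ?powR_gt0. Qed.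

Lemma gmeanM t a b c d : 0 < a -> 0 < b -> 0 < c -> 0 < d ->
  gmean t (a * c) (b * d) = gmean t a b * gmean t c d.
Proof.
move=> a0 b0 c0 d0; rewrite /gmean !powRM ?(ltW a0, ltW b0, ltW c0, ltW d0)//.
by ring.
Qed.

Lemma gmeanxx t a : 0 < a -> gmean t a a = a.
Proof.
move=> a0; rewrite /gmean -powRD; last by rewrite (gt_eqF a0) implybT.
by rewrite addrC subrK powRr1 ?ltW.
Qed.

Lemma gmean_powR t a b q : 0 < a -> 0 < b ->
  gmean t (a `^ q) (b `^ q) = gmean t a b `^ q.
Proof.
move=> a0 b0; rewrite /gmean powRM; [|exact: powR_ge0|exact: powR_ge0].
by rewrite -!powRrM (mulrC q t) (mulrC q (1 - t)).
Qed.

Lemma le_gmean t a b c d : 0 <= t <= 1 -> 0 < a -> 0 < b -> a <= c -> b <= d ->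
  gmean t a b <= gmean t c d.
Proof.
move=> /andP[t0 t1] a0 b0 ac bd; apply: ler_pM; rewrite ?powR_ge0//.
  by apply: ge0_ler_powR; rewrite ?nnegrE ?(ltW a0)// (le_trans (ltW a0)).
apply: ge0_ler_powR; rewrite ?nnegrE ?subr_ge0// ?(ltW b0)//.
exact: le_trans (ltW b0) bd.
Qed.

Lemma lt_gmean t a b c d : 0 < t < 1 -> 0 < a -> 0 < b -> a <= c -> b <= d ->
  (a < c) || (b < d) -> gmean t a b < gmean t c d.
Proof.
move=> /andP[t0 t1] a0 b0 ac bd.
have t1' : 0 < 1 - t by rewrite subr_gt0.
have ac' : a `^ t <= c `^ t.
  exact: le_powR_gt0.
have bd' : b `^ (1 - t) <= d `^ (1 - t).
  exact: le_powR_gt0.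
have c0 := lt_le_trans a0 ac; have d0 := lt_le_trans b0 bd.
move=> /orP[lt|lt].
  apply: (@lt_le_trans _ _ (c `^ t * b `^ (1 - t))).
    by rewrite ltr_pM2r ?powR_gt0//; apply: gt0_ltr_powR; rewrite ?nnegrE ?ltW.
  by rewrite ler_pM2l ?powR_gt0.
apply: (@lt_le_trans _ _ (a `^ t * d `^ (1 - t))).
  by rewrite ltr_pM2l ?powR_gt0//; apply: gt0_ltr_powR; rewrite ?nnegrE ?ltW.
by rewrite ler_pM2r ?powR_gt0.
Qed.

Lemma gmeanE t a b : 0 < a -> 0 < b ->
  gmean t a b = expR (t * ln a + (1 - t) * ln b).
Proof. by move=> a0 b0; rewrite /gmean /powR !gt_eqF// expRD. Qed.

(** The tangent to [ln] at the arithmetic mean [m] lies above [ln]; averaging the tangent bounds at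
    [a] and [b] cancels the linear terms and leaves [ln m]. *)
Lemma gmean_le_amean t a b : 0 <= t <= 1 -> 0 < a -> 0 < b ->
  gmean t a b <= t * a + (1 - t) * b.
Proof.
move=> /andP[t0 t1] a0 b0; set m := t * a + _.
have m0 : 0 < m.
  rewrite /m; have [->|t0'] := eqVneq t 0.
    by rewrite mul0r add0r subr0 mul1r.
  have t_gt0 : 0 < t by rewrite lt_neqAle eq_sym t0'.
  by rewrite ltr_pwDl ?mulr_gt0 ?mulr_ge0 ?subr_ge0// ltW.
have lnle (x : R) : 0 < x -> ln x <= ln m + (x / m - 1).
  move=> x0; rewrite -lerBlDl -ln_div ?posrE//.
  have := @le_ln1Dx R (x / m - 1); rewrite subrKC; apply.
  by rewrite ltrBrDl subrr divr_gt0.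
rewrite gmeanE// -[leRHS]lnK ?posrE// ler_expR.
have -> : ln m = t * (ln m + (a / m - 1)) + (1 - t) * (ln m + (b / m - 1)).
  have : t * (a / m) + (1 - t) * (b / m) = 1.
    by rewrite !mulrA -mulrDl divff ?gt_eqF.
  by move=> e; rewrite -[LHS]addr0 -(subrr 1) -{1}e; ring.
by apply: lerD; apply: ler_wpM2l; rewrite ?subr_ge0// lnle.
Qed.

(** Same tangent argument, where the tangent is strictly above [ln] away from [m]; for [0 < t < 1]
    and [a != b] neither argument equals [m]. *)
Lemma gmean_lt_amean t a b : 0 < t < 1 -> 0 < a -> 0 < b -> a != b ->
  gmean t a b < t * a + (1 - t) * b.
Proof.
move=> /andP[t0 t1] a0 b0 ab; set m := t * a + _.
have t1' : 0 < 1 - t by rewrite subr_gt0.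
have m0 : 0 < m by rewrite addr_gt0 ?mulr_gt0.
have lnle (x : R) : 0 < x -> x != m -> ln x < ln m + (x / m - 1).
  move=> x0 xm; rewrite -ltrBlDl -ln_div ?posrE//.
  rewrite -ltr_expR lnK ?posrE ?divr_gt0// -[ltLHS](subrKC 1).
  have := @expR_gt1Dx R (x / m - 1); apply; rewrite subr_eq0.
  apply: contra xm => /eqP xm.
  have mN0 : m != 0 by rewrite gt_eqF.
  by rewrite -[x](divfK mN0) xm mul1r.
rewrite gmeanE// -[ltRHS]lnK ?posrE// ltr_expR.
have -> : ln m = t * (ln m + (a / m - 1)) + (1 - t) * (ln m + (b / m - 1)).
  have : t * (a / m) + (1 - t) * (b / m) = 1.
    by rewrite !mulrA -mulrDl divff ?gt_eqF.
  by move=> e; rewrite -[LHS]addr0 -(subrr 1) -{1}e; ring.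
apply: ltrD; rewrite ltr_pM2l//; apply: lnle => //; apply: contra ab => /eqP.
  rewrite /m => e; have : (1 - t) * (a - b) = 0.
    by rewrite mulrBr {1}mulrBl mul1r {1}e; ring.
  by move/eqP; rewrite mulf_eq0 (gt_eqF t1')/= subr_eq0.
rewrite /m => e; have : t * (a - b) = 0 by rewrite -(subrr b) {2}e; ring.
by move/eqP; rewrite mulf_eq0 (gt_eqF t0)/= subr_eq0.
Qed.

End geometric_mean.

Section gmean_weights.
Variables (R : realType) (t x y : R).
Hypotheses (x0 : 0 < x) (y0 : 0 < y).

(** With G the geometric mean of x and y, the weights G/x and G/y have geometric mean 1 and send
    both x and y to G, so weighted AM-GM is an equality for them. They are the normalization in the
    proof of Hoelder's inequality. *)
Lemma gmean_weights : gmean t (gmean t x y / x) (gmean t x y / y) = 1.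
Proof.
have g0 : 0 < gmean t x y by rewrite gmean_gt0.
rewrite gmeanM ?invr_gt0// gmeanxx//.
have -> : gmean t x^-1 y^-1 = (gmean t x y)^-1.
  apply: (mulfI (lt0r_neq0 g0)); rewrite divff ?gt_eqF// -gmeanM ?invr_gt0//.
  by rewrite !divff ?gt_eqF// gmeanxx.
by rewrite divff ?gt_eqF.
Qed.

Lemma gmean_weights_amean :
  t * (gmean t x y / x) * x + (1 - t) * (gmean t x y / y) * y = gmean t x y.
Proof.
by rewrite -!mulrA !mulVf ?gt_eqF// !mulr1 -mulrDl subrKC mul1r.
Qed.

End gmean_weights.

(** * Quadratic forms of inverse matrices *)

Section positive_definite.
Variables (R : realType) (n : nat).
Implicit Types (x y z : 'cV[R]_n) (M : 'M[R]_n).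

Definition dotv n (x y : 'cV[R]_n) : R := (x^T *m y) ord0 ord0.

Lemma dotvE x y : dotv x y = \sum_i x i ord0 * y i ord0.
Proof. by rewrite /dotv mxE; apply: eq_bigr => i _; rewrite mxE. Qed.

Lemma dotvC x y : dotv x y = dotv y x.
Proof. by rewrite !dotvE; apply: eq_bigr => i _; rewrite mulrC. Qed.

Lemma dotvDr x y z : dotv x (y + z) = dotv x y + dotv x z.
Proof. by rewrite /dotv mulmxDr mxE. Qed.

Lemma dotvDl x y z : dotv (y + z) x = dotv y x + dotv z x.
Proof. by rewrite dotvC dotvDr !(dotvC x). Qed.

Lemma dotvZr a x y : dotv x (a *: y) = a * dotv x y.
Proof. by rewrite /dotv -scalemxAr mxE. Qed.

Lemma dotvZl a x y : dotv (a *: y) x = a * dotv y x.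
Proof. by rewrite dotvC dotvZr dotvC. Qed.

Lemma dotvNr x y : dotv x (- y) = - dotv x y.
Proof. by rewrite -scaleN1r dotvZr mulN1r. Qed.

Lemma dotvNl x y : dotv (- y) x = - dotv y x.
Proof. by rewrite dotvC dotvNr dotvC. Qed.

Lemma dotvBr x y z : dotv x (y - z) = dotv x y - dotv x z.
Proof. by rewrite dotvDr dotvNr. Qed.

Lemma dotvBl x y z : dotv (y - z) x = dotv y x - dotv z x.
Proof. by rewrite dotvDl dotvNl. Qed.

Lemma dotv0r x : dotv x 0 = 0.
Proof. by rewrite -(scale0r x) dotvZr mul0r. Qed.

Lemma dotv0l x : dotv 0 x = 0.
Proof. by rewrite dotvC dotv0r. Qed.

Lemma dotv_mull M x y : dotv (M *m x) y = dotv x (M^T *m y).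
Proof. by rewrite /dotv trmx_mul mulmxA. Qed.

Lemma cV_neq0_coord y : y != 0 -> exists i, y i ord0 != 0.
Proof.
move=> y0; apply/existsP; apply: contraNT y0.
rewrite negb_exists => /forallP y0.
by apply/eqP/colP => i; rewrite mxE; apply/eqP; have := y0 i; rewrite negbK.
Qed.

Definition posdefmx M : Prop :=
  M^T = M /\ forall y, y != 0 -> 0 < dotv y (M *m y).

Lemma posdefmx_ge0 M y : posdefmx M -> 0 <= dotv y (M *m y).
Proof.
move=> [_ M0]; have [->|/M0/ltW//] := eqVneq y 0; by rewrite dotv0l.
Qed.

(** By symmetry, the transpose of a nonzero row in the left kernel would be a nonzero vector on
    which the quadratic form vanishes. *)
Lemma posdefmx_unit M : posdefmx M -> M \in unitmx.
Proof.
move=> [MT M0]; rewrite -row_free_unit -kermx_eq0; apply/eqP/row_matrixP => i.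
rewrite row0; apply/eqP/negPn/negP => r0.
have := M0 (row i (kermx M))^T; rewrite -trmx0 (inj_eq trmx_inj) => /(_ r0).
have -> : M *m (row i (kermx M))^T = 0.
  apply: trmx_inj; rewrite trmx_mul trmxK MT trmx0; apply/sub_kermxP.
  exact: row_sub.
by rewrite dotv0r ltxx.
Qed.

(** Completing the square around the critical point [b] of the concave function on the left. *)
Lemma posdefmx_gap M (c b y : 'cV[R]_n) : M^T = M -> M *m b = c ->
  2 * dotv c y - dotv y (M *m y) =
  dotv c b - dotv (y - b) (M *m (y - b)).
Proof.
move=> MT Mb.
rewrite mulmxBr !dotvBl !dotvBr Mb.
have -> : dotv b (M *m y) = dotv c y by rewrite -{1}MT -dotv_mull Mb.
rewrite (dotvC y c) (dotvC b c); ring.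
Qed.

End positive_definite.

Section inverse_quadratic_form.
Variables (R : realType) (n : nat).
Implicit Types (M Mx My : 'M[R]_n) (al t : R) (c : 'cV[R]_n).

Definition invquad al c M : R := al + dotv c (invmx M *m c).

(** Variational form of c^T M^-1 c: it is the maximum over y of an expression affine in M, attained
    at y = M^-1 c. All comparisons of [invquad] below rest on it. *)
Lemma invquad_max M al c y : posdefmx M ->
  al + (2 * dotv c y - dotv y (M *m y)) <= invquad al c M.
Proof.
move=> pM; rewrite lerD2l (@posdefmx_gap _ _ M c (invmx M *m c)).
- by rewrite gerBl posdefmx_ge0.
- by case: pM.
- by rewrite mulKVmx// posdefmx_unit.
Qed.

Lemma invquad_lt_max M al c y : posdefmx M -> M *m y != c ->
  al + (2 * dotv c y - dotv y (M *m y)) < invquad al c M.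
Proof.
move=> pM Myc; have uM := posdefmx_unit pM.
rewrite ltrD2l (@posdefmx_gap _ _ M c (invmx M *m c)).
- rewrite gtrBl; apply: pM.2; rewrite subr_eq0.
  by apply: contra Myc => /eqP ->; rewrite mulKVmx.
- by case: pM.
- by rewrite mulKVmx.
Qed.

Lemma invquadE M al c : posdefmx M -> let y := invmx M *m c in
  invquad al c M = al + dotv y (M *m y).
Proof. by move=> pM /=; rewrite mulKVmx ?posdefmx_unit// dotvC. Qed.

Lemma invquad_gt0 M al c : posdefmx M -> 0 <= al -> (c = 0 -> 0 < al) ->
  0 < invquad al c M.
Proof.
move=> pM al0 c0; rewrite invquadE//=.
have [/c0|cN0] := eqVneq c 0.
  by move/ltr_pwDl; apply; exact: posdefmx_ge0.
rewrite ltr_wpDl//; apply: pM.2; apply: contra cN0 => /eqP y0.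
by rewrite -(mulKVmx (posdefmx_unit pM) c) y0 mulmx0.
Qed.

(* Cauchy-Schwarz in the inner product of M. *)
Lemma invquad_CS M al c y : posdefmx M -> 0 <= al ->
  (al + dotv c y) ^+ 2 <= invquad al c M * (al + dotv y (M *m y)).
Proof.
move=> pM al0; set k := dotv c (invmx M *m c); set m := dotv y _.
(* The variational bound along the line through [y]: r = c^T y / m, the best choice, gives
   Cauchy-Schwarz, and r = 1 controls the cross term with [al]. *)
have gap (r : R) : 2 * r * dotv c y - r ^+ 2 * m <= k.
  have := invquad_max 0 c (r *: y) pM.
  by rewrite /invquad !add0r -scalemxAr !dotvZr !dotvZl !mulrA -expr2.
have CS : dotv c y ^+ 2 <= k * m.
  have [m0|m0] := eqVneq m 0.
    have [->|y0] := eqVneq y 0; first by rewrite dotv0r expr0n/= m0 mulr0.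
    by have := pM.2 _ y0; rewrite -/m m0 ltxx.
  have m_gt0 : 0 < m by rewrite lt_neqAle eq_sym m0 posdefmx_ge0.
  rewrite -ler_pdivrMr//; apply: le_trans (gap (dotv c y / m)).
  by rewrite le_eqVlt; apply/orP; left; apply/eqP; field.
have := gap 1; rewrite expr1n mulr1 mul1r lerBlDr => {}gap.
rewrite /invquad -/k -/m.
have -> : (al + k) * (al + m) = al ^+ 2 + al * (k + m) + k * m by ring.
have -> : (al + dotv c y) ^+ 2 = al ^+ 2 + al * (2 * dotv c y) + dotv c y ^+ 2.
  by ring.
by apply: lerD => //; rewrite lerD2l ler_wpM2l.
Qed.

(** The maximizer for M' is a competitor for M, where the subtracted quadratic term is smaller. *)
Lemma invquad_antitone M M' al c : posdefmx M -> posdefmx M' ->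
  (forall y, dotv y (M *m y) <= dotv y (M' *m y)) ->
  invquad al c M' <= invquad al c M.
Proof.
move=> pM pM' MM'; set y := invmx M' *m c.
apply: le_trans (invquad_max _ _ y pM); rewrite [leLHS]/invquad lerD2l.
have := posdefmx_gap y pM'.1 (mulKVmx (posdefmx_unit pM') c).
by rewrite -/y subrr dotv0l subr0; have := MM' y; lra.
Qed.

Lemma invquad_lt_antitone M M' al c : posdefmx M -> posdefmx M' -> c != 0 ->
  (forall y, y != 0 -> dotv y (M *m y) < dotv y (M' *m y)) ->
  invquad al c M' < invquad al c M.
Proof.
move=> pM pM' c0 MM'; set y := invmx M' *m c.
have y0 : y != 0.
  apply: contra c0 => /eqP y0.
  by rewrite -(mulKVmx (posdefmx_unit pM') c) -/y y0 mulmx0.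
apply: lt_le_trans (invquad_max _ _ y pM); rewrite [ltLHS]/invquad ltrD2l.
have := posdefmx_gap y pM'.1 (mulKVmx (posdefmx_unit pM') c).
by rewrite -/y subrr dotv0l subr0; have := MM' y y0; lra.
Qed.

(** * Log-convexity of the inverse quadratic form in the matrix *)

Section log_convexity.
Variables (Mx My : 'M[R]_n) (al t : R) (c : 'cV[R]_n).
Hypotheses (pMx : posdefmx Mx) (pMy : posdefmx My).
Hypotheses (al0 : 0 <= al) (cal : c = 0 -> 0 < al).

Let Mz := t *: Mx + (1 - t) *: My.
Let y := invmx Mz *m c.

Hypothesis pMz : posdefmx Mz.

Let dotMz : dotv c y = t * dotv y (Mx *m y) + (1 - t) * dotv y (My *m y).
Proof.
rewrite -[in LHS](mulKVmx (posdefmx_unit pMz) c) -/y dotvC.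
by rewrite /Mz mulmxDl -!scalemxAl dotvDr !dotvZr.
Qed.

Let invquad_mean : invquad al c Mz =
  t * (al + dotv y (Mx *m y)) + (1 - t) * (al + dotv y (My *m y)).
Proof. rewrite /invquad -/y dotMz; ring. Qed.

Let den_gt0 M : posdefmx M -> 0 < al + dotv y (M *m y).
Proof.
move=> pM; have [/cal|cN0] := eqVneq c 0.
  by move/ltr_pwDl; apply; exact: posdefmx_ge0.
rewrite ltr_wpDl//; apply: pM.2; apply: contra cN0 => /eqP y0.
by rewrite -(mulKVmx (posdefmx_unit pMz) c) -/y y0 mulmx0.
Qed.

(** Cauchy-Schwarz at [Mx] and at [My] with the same vector [y], optimal for [Mz]: both left sides
    are the square of the value at [Mz], hence so is their geometric mean. *)
Let sqr_le : 0 <= t <= 1 ->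
  invquad al c Mz ^+ 2 <= gmean t (invquad al c Mx) (invquad al c My) *
    gmean t (al + dotv y (Mx *m y)) (al + dotv y (My *m y)).
Proof.
move=> t01; have S0 : 0 < invquad al c Mz by exact: invquad_gt0.
have Sx0 : 0 < invquad al c Mx by exact: invquad_gt0.
have Sy0 : 0 < invquad al c My by exact: invquad_gt0.
rewrite -gmeanM ?den_gt0// -[leLHS](@gmeanxx _ t) ?exprn_gt0//.
by apply: le_gmean => //; rewrite ?exprn_gt0//; exact: invquad_CS.
Qed.

(** In [sqr_le], AM-GM bounds the second factor by its arithmetic mean, which is again the value at
    [Mz] by [invquad_mean]; one factor then cancels. *)
Lemma invquad_logconvex : 0 <= t <= 1 ->
  invquad al c Mz <= gmean t (invquad al c Mx) (invquad al c My).
Proof.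
move=> t01; have S0 : 0 < invquad al c Mz by exact: invquad_gt0.
rewrite -(ler_pM2r S0) -expr2; apply: le_trans (sqr_le t01) _.
rewrite ler_pM2l ?gmean_gt0 ?invquad_gt0// invquad_mean.
by apply: gmean_le_amean => //; exact: den_gt0.
Qed.

(** If y^T Mx y and y^T My y differ, AM-GM is strict. If they agree, both equal c^T y, so [y] yields
    the value at [Mz] in both maximum problems; it cannot be optimal in both, as Mx y and My y are
    not both c. *)
Lemma invquad_strictly_logconvex : 0 < t < 1 -> al = 0 -> Mx *m y != My *m y ->
  invquad al c Mz < gmean t (invquad al c Mx) (invquad al c My).
Proof.
move=> t01 alE neq; have S0 : 0 < invquad al c Mz by exact: invquad_gt0.
have t01' : 0 <= t <= 1 by case/andP: t01 => *; apply/andP; split; apply: ltW.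
have [e|ne] := eqVneq (al + dotv y (Mx *m y)) (al + dotv y (My *m y));
  last first.
  rewrite -(ltr_pM2r S0) -expr2; apply: le_lt_trans (sqr_le t01') _.
  rewrite ltr_pM2l ?gmean_gt0 ?invquad_gt0// [ltRHS]invquad_mean.
  by apply: gmean_lt_amean => //; exact: den_gt0.
have ex : dotv y (Mx *m y) = dotv c y.
  by move/addrI: e => e; rewrite dotMz -e; ring.
have ey : dotv y (My *m y) = dotv c y by move/addrI: e => <-.
have SE : invquad al c Mz = al + (2 * dotv c y - dotv c y).
  by rewrite /invquad -/y; ring.
rewrite -[ltLHS](@gmeanxx _ t)//; apply: lt_gmean => //.
- by rewrite SE -{2}ex invquad_max.
- by rewrite SE -{2}ey invquad_max.
- rewrite {1 2}SE -{2}ex -{3}ey; apply/orP.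
  have [ec|] := eqVneq (Mx *m y) c; [right|left]; apply: invquad_lt_max => //.
  by rewrite -ec eq_sym.
Qed.

End log_convexity.

End inverse_quadratic_form.

(** * Posterior variance *)

Section posterior_variance_formula.
Variables (R : realType) (d N : nat) (k : 'rV[R]_d -> 'rV[R]_d -> R).
Variables (P : 'I_N -> 'rV[R]_d).
Hypotheses (kcov : covariance_kernel k) (Pinj : injective P).
Implicit Types (v : 'rV[R]_N) (p : 'rV[R]_d).

Definition gram_mx : 'M[R]_N := \matrix_(i, j) k (P i) (P j).

Definition cross_cov p : 'cV[R]_N := \col_i k (P i) p.

(* K0 (K0^-1 + diag v) K0, where K0 is the Gram matrix: it is affine in v. *)
Definition info_mx v : 'M[R]_N :=
  gram_mx + gram_mx *m diag_mx v *m gram_mx.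

(* Posterior variance at p for exact evaluations, i.e. for v = oo. *)
Definition residual_var p : R :=
  k p p - dotv (cross_cov p) (invmx gram_mx *m cross_cov p).

Lemma kernel_sym p q : k p q = k q p.
Proof. by case: kcov. Qed.

Lemma gram_mx_sym : gram_mx^T = gram_mx.
Proof. by apply/matrixP => i j; rewrite !mxE kernel_sym. Qed.

Lemma gram_mx_posdef : posdefmx gram_mx.
Proof.
split; first exact: gram_mx_sym.
move=> y y0; case: kcov => _ _ _ /(_ N P (y^~ ord0) Pinj).
move=> /(_ (cV_neq0_coord y0)); congr (0 < _); rewrite dotvE.
apply: eq_bigr => i _.
rewrite mxE mulr_sumr; apply: eq_bigr => j _; rewrite !mxE; ring.
Qed.

(** Exhibits the form as a positive definite part plus a part with nonnegative coefficients linear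
    in [v]: positivity and monotonicity in [v] are read off from it. *)
Lemma dotv_info_mx v y : dotv y (info_mx v *m y) =
  dotv y (gram_mx *m y) + \sum_i v ord0 i * ((gram_mx *m y) i ord0) ^+ 2.
Proof.
rewrite /info_mx mulmxDl dotvDr; congr (_ + _).
rewrite -!mulmxA -[X in dotv y (X *m _)]gram_mx_sym -dotv_mull dotvE.
by apply: eq_bigr => i _; rewrite mul_diag_mx [X in _ * X]mxE; ring.
Qed.

Lemma info_mx_posdef v : nonneg_orthant v -> posdefmx (info_mx v).
Proof.
move=> v0; split.
  rewrite /info_mx [in LHS]linearD/= !trmx_mul gram_mx_sym tr_diag_mx.
  by rewrite mulmxA.
move=> y y0; rewrite dotv_info_mx ltr_pwDl ?gram_mx_posdef.2//.
by apply: sumr_ge0 => i _; rewrite mulr_ge0 ?sqr_ge0//; exact: v0.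
Qed.

Lemma info_mx_conv t v1 v2 :
  info_mx (t *: v1 + (1 - t) *: v2) = t *: info_mx v1 + (1 - t) *: info_mx v2.
Proof.
rewrite /info_mx.
have -> : diag_mx (t *: v1 + (1 - t) *: v2) =
    t *: diag_mx v1 + (1 - t) *: diag_mx v2.
  by rewrite linearD/= !linearZ.
rewrite mulmxDr mulmxDl -!scalemxAr -!scalemxAl !scalerDr addrACA -scalerDl.
by rewrite subrKC scale1r.
Qed.

Lemma kernel_diag_gt0 p : 0 < k p p.
Proof.
case: kcov => _ _ _ /(_ 1%N (fun=> p) (fun=> 1)).
rewrite !big_ord1 !mul1r; apply; last by exists ord0; exact: oner_neq0.
by move=> i j _; rewrite !ord1.
Qed.

Lemma cross_cov_point i : cross_cov (P i) = gram_mx *m delta_mx i ord0.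
Proof. by rewrite -colE; apply/colP => j; rewrite !mxE. Qed.

Lemma residual_var_point i : residual_var (P i) = 0.
Proof.
rewrite /residual_var {2}cross_cov_point mulKmx; last first.
  exact/posdefmx_unit/gram_mx_posdef.
by rewrite /dotv -colE !mxE subrr.
Qed.

Lemma augmented_pointsl p i : augmented_points P p (lshift 1 i) = P i.
Proof. by rewrite /augmented_points (unsplitK (inl _ i)). Qed.

Lemma augmented_pointsr p i : augmented_points P p (rshift N i) = p.
Proof. by rewrite /augmented_points (unsplitK (inr _ i)). Qed.

Lemma covariance_mxE p : covariance_mx k P p =
  block_mx gram_mx (cross_cov p) (cross_cov p)^T (const_mx (k p p)).
Proof.
apply/matrixP => a b; rewrite /covariance_mx mxE.
case: (split_ordP a) => i ->; case: (split_ordP b) => j ->.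
- by rewrite block_mxEul !augmented_pointsl mxE.
- by rewrite block_mxEur augmented_pointsl augmented_pointsr mxE.
- by rewrite block_mxEdl augmented_pointsl augmented_pointsr !mxE kernel_sym.
- by rewrite block_mxEdr !augmented_pointsr mxE.
Qed.

(** This is the Schur complement of the Gram matrix in the augmented covariance matrix, that is, the
    quadratic form of the latter at the vector (-K0^-1 kappa, 1). At an evaluation point the
    augmented points are not distinct, but there the residual is 0. *)
Lemma residual_var_ge0 p : 0 <= residual_var p.
Proof.
have [[i <-]|pP] := pselect (exists i, P i = p).
  by rewrite residual_var_point.
pose b := invmx gram_mx *m cross_cov p.
pose c : 'cV[R]_(N + 1) := col_mx (- b) 1%:M.
have uK : gram_mx \in unitmx by exact/posdefmx_unit/gram_mx_posdef.
have inj : injective (augmented_points P p).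
  move=> a a'.
  case: (split_ordP a) => i ->; case: (split_ordP a') => j ->;
    rewrite ?augmented_pointsl ?augmented_pointsr => e.
  - by rewrite (Pinj e).
  - by case: pP; exists i.
  - by case: pP; exists j.
  - by rewrite !ord1.
case: kcov => _ _ _ /(_ _ (augmented_points P p) (c^~ ord0) inj).
have c0 : exists a, c a ord0 != 0.
  by exists (rshift N ord0); rewrite /c col_mxEd mxE oner_eq0.
move=> /(_ c0) pd; apply: ltW; move: pd; congr (0 < _).
transitivity (dotv c (covariance_mx k P p *m c)).
  rewrite dotvE; apply: eq_bigr => i _.
  rewrite [X in _ = _ * X]mxE mulr_sumr; apply: eq_bigr => j _.
  by rewrite [X in _ = _ * (X * _)]mxE; ring.
rewrite covariance_mxE /c mul_block_col mulmxN mulKVmx// mulmx1 addNr.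
rewrite /dotv tr_col_mx mul_row_col mulmx0 add0r trmx1 mul1mx.
by rewrite mulmx1 mulmxN /residual_var /dotv -/b !mxE addrC.
Qed.

(** Instead of inverting I + K V, the proof solves (I + K V) s = K e by blocks and reads off the
    last coordinate of s. This treats singular and invertible K alike. *)
Lemma posterior_varianceE v p : nonneg_orthant v ->
  posterior_variance k P v p =
  invquad (residual_var p) (cross_cov p) (info_mx v).
Proof.
move=> v0; set K := covariance_mx k P p; set V := precision_mx v.
have uK0 : gram_mx \in unitmx by exact/posdefmx_unit/gram_mx_posdef.
have pM := info_mx_posdef v0; have uM := posdefmx_unit pM.
have VE : V = block_mx (diag_mx v) 0 0 0.
  by rewrite /V /precision_mx diag_mx_row; congr block_mx; rewrite linear0.
have KVE : 1%:M + K *m V =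
    block_mx (1%:M + gram_mx *m diag_mx v) 0
             ((cross_cov p)^T *m diag_mx v) 1%:M.
  rewrite /K covariance_mxE VE mulmx_block !mulmx0 !addr0.
  by rewrite scalar_mx_block add_block_mx !addr0 !add0r.
have ME : info_mx v = (1%:M + gram_mx *m diag_mx v) *m gram_mx.
  by rewrite mulmxDl mul1mx.
(* I + K V is block lower triangular, and its nontrivial diagonal block is a left factor of the
   invertible [info_mx v]. *)
have uKV : 1%:M + K *m V \in unitmx.
  rewrite KVE unitmxE det_lblock det1 mulr1 -unitmxE.
  by move: uM; rewrite ME unitmx_mul => /andP[].
have SE : posterior_covariance_mx K V = invmx (1%:M + K *m V) *m K.
  rewrite /posterior_covariance_mx; case: ifPn => // uK.
  have -> : invmx K + V = invmx K *m (1%:M + K *m V).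
    by rewrite mulmxDr mulmx1 mulmxA mulVmx// mul1mx.
  have e : invmx K *m (1%:M + K *m V) *m (invmx (1%:M + K *m V) *m K) = 1%:M.
    by rewrite mulmxA mulmxK// mulVmx.
  by have [u _] := mulmx1_unit e; rewrite -[RHS](mulKmx u) e mulmx1.
pose b := invmx (info_mx v) *m cross_cov p.
(* The upper block solves the first N equations, since (I + K0 diag(v)) K0 = M_v; the lower entry is
   then forced by the last equation. *)
pose s : 'cV[R]_(N + 1) := col_mx (gram_mx *m b)
  (const_mx (k p p) - (cross_cov p)^T *m diag_mx v *m (gram_mx *m b)).
have Mb : info_mx v *m b = cross_cov p by rewrite mulKVmx.
pose e : 'cV[R]_(N + 1) := delta_mx (rshift N ord0) ord0.
have eE : e = col_mx 0 1%:M.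
  apply/colP => a; case: (split_ordP a) => i ->.
    by rewrite col_mxEu !mxE eq_lrshift.
  by rewrite col_mxEd !mxE !ord1 !eqxx.
have sE : (1%:M + K *m V) *m s = K *m e.
  rewrite KVE /s mul_block_col eE /K covariance_mxE mul_block_col.
  rewrite !mulmx0 !mul0mx !add0r addr0 !mulmx1 mul1mx mulmxA -ME Mb.
  by rewrite subrKC.
rewrite /posterior_variance -/K -/V -/e SE -!mulmxA -sE (mulKmx uKV).
(* Rewriting M_v b = kappa as K0 (b + diag(v) K0 b) = kappa removes [v] from the last coordinate
   except through [b]. *)
have VK0b : diag_mx v *m (gram_mx *m b) = invmx gram_mx *m cross_cov p - b.
  rewrite -{1}Mb /info_mx mulmxDl mulmxDr (mulKmx uK0) addrAC subrr add0r.
  by rewrite -!mulmxA (mulKmx uK0).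
rewrite eE /s tr_col_mx mul_row_col trmx0 mul0mx add0r trmx1 mul1mx.
rewrite -mulmxA VK0b mulmxBr.
rewrite /invquad /residual_var -/b /dotv !mxE; ring.
Qed.

Lemma posterior_variance_gt0 v p : nonneg_orthant v ->
  0 < posterior_variance k P v p.
Proof.
move=> v0; rewrite posterior_varianceE//; apply: invquad_gt0.
- exact: info_mx_posdef.
- exact: residual_var_ge0.
- by move=> c0; rewrite /residual_var c0 dotv0l subr0 kernel_diag_gt0.
Qed.

(** The prior variance is the same inverse quadratic form at v = 0, where the information matrix is
    the Gram matrix. *)
Lemma posterior_variance_le_prior v p : nonneg_orthant v ->
  posterior_variance k P v p <= k p p.
Proof.
move=> v0; rewrite posterior_varianceE//.
have -> : k p p = invquad (residual_var p) (cross_cov p) gram_mx.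
  by rewrite /invquad /residual_var subrK.
apply: invquad_antitone.
- exact: gram_mx_posdef.
- exact: info_mx_posdef.
move=> y; rewrite dotv_info_mx lerDl.
by apply: sumr_ge0 => i _; rewrite mulr_ge0 ?sqr_ge0//; exact: v0.
Qed.

Lemma posterior_variance_lt v v' p : nonneg_orthant v ->
  (forall i, v ord0 i < v' ord0 i) -> cross_cov p != 0 ->
  posterior_variance k P v' p < posterior_variance k P v p.
Proof.
move=> v0 vv' c0; have v'0 : nonneg_orthant v'.
  by move=> i; apply/ltW/(le_lt_trans _ (vv' i)); exact: v0.
rewrite !posterior_varianceE//; apply: invquad_lt_antitone => //;
  try exact: info_mx_posdef.
move=> y y0; rewrite !dotv_info_mx ltrD2l.
(* As K0 is invertible, some coordinate of K0 y is nonzero, and the increase of [v] in that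
   coordinate is strictly felt. *)
set z := gram_mx *m y; have z0 : z != 0.
  apply: contra y0 => /eqP z0.
  by rewrite -(mulKmx (posdefmx_unit gram_mx_posdef) y) -/z z0 mulmx0.
have [i zi] := cV_neq0_coord z0.
rewrite (bigD1 i)//= [ltRHS](bigD1 i)//=; apply: ltr_leD.
  by rewrite ltr_pM2r// lt_neqAle eq_sym sqrf_eq0 zi sqr_ge0.
by apply: ler_sum => l _; rewrite ler_wpM2r ?sqr_ge0// ltW.
Qed.

Section convex_combination.
Variables (t : R) (v1 v2 : 'rV[R]_N).
Hypotheses (v10 : nonneg_orthant v1) (v20 : nonneg_orthant v2).

Lemma nonneg_orthant_conv : 0 <= t <= 1 ->
  nonneg_orthant (t *: v1 + (1 - t) *: v2).
Proof.
move=> /andP[t0 t1] i; by rewrite !mxE addr_ge0// mulr_ge0// ?subr_ge0.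
Qed.

Lemma posterior_variance_logconvex p : 0 <= t <= 1 ->
  posterior_variance k P (t *: v1 + (1 - t) *: v2) p <=
  gmean t (posterior_variance k P v1 p) (posterior_variance k P v2 p).
Proof.
move=> t01; have v0 := nonneg_orthant_conv t01.
rewrite !posterior_varianceE// info_mx_conv; apply: invquad_logconvex => //.
- exact: info_mx_posdef.
- exact: info_mx_posdef.
- exact: residual_var_ge0.
- by move=> c0; rewrite /residual_var c0 dotv0l subr0 kernel_diag_gt0.
- by rewrite -info_mx_conv; exact: info_mx_posdef.
Qed.

(* With M_v the information matrix and y := M_v^-1 k(P, P i) at the midpoint,
   equality would force K0 diag(v1 - v2) K0 y = 0, whereas (K0 y)_i > 0. *)
Lemma posterior_variance_strictly_logconvex i : 0 < t < 1 ->
  v1 ord0 i != v2 ord0 i ->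
  posterior_variance k P (t *: v1 + (1 - t) *: v2) (P i) <
  gmean t (posterior_variance k P v1 (P i)) (posterior_variance k P v2 (P i)).
Proof.
move=> t01 v12; have t01' : 0 <= t <= 1.
  by case/andP: t01 => *; apply/andP; split; apply: ltW.
have v0 := nonneg_orthant_conv t01'.
have pM := info_mx_posdef v0.
have uK : gram_mx \in unitmx by exact/posdefmx_unit/gram_mx_posdef.
rewrite !posterior_varianceE// info_mx_conv.
apply: invquad_strictly_logconvex => //.
- exact: info_mx_posdef.
- exact: info_mx_posdef.
- exact: residual_var_ge0.
- by move=> c0; rewrite /residual_var c0 dotv0l subr0 kernel_diag_gt0.
- by rewrite -info_mx_conv.
- exact: residual_var_point.
rewrite -info_mx_conv; set y := _ *m cross_cov (P i).
have My : info_mx (t *: v1 + (1 - t) *: v2) *m y = cross_cov (P i).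
  by rewrite mulKVmx// posdefmx_unit.
have y0 : y != 0.
  have e0 : dotv (cross_cov (P i)) (delta_mx i ord0) != 0.
    rewrite cross_cov_point dotvC gt_eqF//; apply: gram_mx_posdef.2.
    apply/negP => /eqP/colP/(_ i); rewrite !mxE !eqxx => /eqP.
    by rewrite oner_eq0.
  by apply: contra e0 => /eqP y0; rewrite -My y0 mulmx0 dotv0l.
(* Since k(P, P i) is the i-th column of K0, the entry (K0 y)_i equals y^T M_v y. *)
have Ky : 0 < (gram_mx *m y) i ord0.
  have := pM.2 _ y0; rewrite My dotvC cross_cov_point dotv_mull gram_mx_sym.
  by rewrite /dotv trmx_delta -rowE mxE.
apply/negP => /eqP; rewrite /info_mx !mulmxDl => /addrI.
rewrite -!mulmxA => /(congr1 (mulmx (invmx gram_mx))); rewrite !(mulKmx uK).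
move=> /colP/(_ i); rewrite !mul_diag_mx !mxE => /eqP.
rewrite -subr_eq0 -mulrBl mulf_eq0 subr_eq0 (negPf v12)/=.
by have := Ky; rewrite mxE => /gt_eqF ->.
Qed.

End convex_combination.

Lemma cross_cov_continuous i : continuous (fun p => k (P i) p).
Proof.
case: kcov => kc _ _ _ p.
apply: (@continuous_comp _ _ _ (fun p => (P i, p)) (fun z => k z.1 z.2)).
  exact: (@cvg_pair _ _ _ (nbhs p) (nbhs (P i)) (nbhs p) _ _ _ (fun=> P i) id
    (cvg_cst _) (@cvg_id _ _)).
exact: kc.
Qed.

Lemma kernel_diag p : k p p = k 0 0.
Proof. by case: kcov => _ _ /(_ p 0 0); rewrite !add0r. Qed.

(** By translation invariance k(p, p) is constant, so the posterior variance is a constant plus a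
    quadratic form in the continuous functions k(P i, p), with coefficients not depending on p. *)
Lemma posterior_variance_continuous v : nonneg_orthant v ->
  continuous (posterior_variance k P v).
Proof.
move=> v0; rewrite (_ : posterior_variance k P v = (fun p => k 0 0 +
  \sum_i \sum_j (k (P i) p *
    ((invmx (info_mx v) - invmx gram_mx) i j * k (P j) p)))); last first.
  apply/funext => p; rewrite posterior_varianceE// /invquad /residual_var.
  rewrite kernel_diag -addrA; congr (_ + _); rewrite addrC -dotvBr -mulmxBl.
  rewrite dotvE; apply: eq_bigr => i _; rewrite [X in _ * X]mxE mulr_sumr.
  by apply: eq_bigr => j _; rewrite [X in X * _]mxE [X in _ * (_ * X)]mxE.
have csum : continuous (fun p => \sum_i \sum_j (k (P i) p *
    ((invmx (info_mx v) - invmx gram_mx) i j * k (P j) p))).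
  apply: continuous_sum => i; apply: continuous_sum => j; apply: continuous_mul.
    exact: cross_cov_continuous.
  apply: continuous_mul; last exact: cross_cov_continuous.
  exact: cst_continuous.
move=> p; apply: (@continuousD _ _ _ (cst (k 0 0))); last exact: csum.
exact: cst_continuous.
Qed.

End posterior_variance_formula.

(** * Error models *)

Section spectral_norm_diag.
Variables (R : realType) (m : nat).

(** The largest entry bounds the stretching coordinate by coordinate, and the unit vector at [l0]
    attains the bound. *)
Lemma spectral_norm_diag (s : 'rV[R]_m) (l0 : 'I_m) :
  (forall l, 0 <= s ord0 l <= s ord0 l0) ->
  spectral_norm (diag_mx s) = s ord0 l0.
Proof.
move=> sle; have s0 : 0 <= s ord0 l0 by case/andP: (sle l0).
rewrite /spectral_norm; set A := (X in sup X).
have ubA : ubound A (s ord0 l0).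
  move=> _ [x /= x1 <-]; apply: (@le_trans _ _ (s ord0 l0 * l2norm x)).
    rewrite /l2norm -[X in _ <= X * _](ger0_norm s0) -sqrtr_sqr.
    rewrite -sqrtrM ?sqr_ge0//.
    rewrite ler_wsqrtr// mulr_sumr; apply: ler_sum => i _.
    rewrite mul_diag_mx mxE exprMn ler_wpM2r ?sqr_ge0//.
    by rewrite ler_pXn2r ?nnegrE//; case/andP: (sle i).
  by rewrite -[leRHS]mulr1 ler_wpM2l.
have l2delta l : l2norm (delta_mx l ord0 : 'cV[R]_m) = 1.
  rewrite /l2norm (bigD1 l)//= big1 => [|i /negPf il].
    by rewrite !mxE !eqxx expr1n addr0 sqrtr1.
  by rewrite !mxE il expr0n.
have As : A (s ord0 l0).
  exists (delta_mx l0 ord0) => /=; first by rewrite l2delta.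
  have -> : diag_mx s *m delta_mx l0 ord0 =
      s ord0 l0 *: (delta_mx l0 ord0 : 'cV[R]_m).
    apply/colP => i; rewrite mul_diag_mx !mxE.
    by case: eqVneq => [->|]; rewrite ?andbF ?andbT ?mulr0.
  rewrite /l2norm (eq_bigr (fun i => s ord0 l0 ^+ 2 *
      (delta_mx l0 ord0 : 'cV[R]_m) i ord0 ^+ 2)).
    rewrite -mulr_sumr sqrtrM ?sqr_ge0// sqrtr_sqr ger0_norm//.
    by have := l2delta l0; rewrite /l2norm => ->; rewrite mulr1.
  by move=> i _; rewrite mxE exprMn.
apply/eqP; rewrite eq_le; apply/andP; split.
  by apply: ge_sup => //; exists (s ord0 l0).
by apply: ub_le_sup => //; exists (s ord0 l0).
Qed.

End spectral_norm_diag.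

Section error_aggregate.
Variables (R : realType) (m : nat) (em : error_model) (q : R).
Hypotheses (m0 : (0 < m)%N) (q0 : 0 < q).
Implicit Types f g h : 'I_m -> R.

(* epsilon_v^q in terms of the q-th powers of the component deviations *)
Definition aggregate f : R :=
  match em with
  | SpectralModel => (m%:R * (1 - 2 / (9 * m%:R)) ^+ 3) `^ (q / 2) *
      \big[Num.max/0]_l f l
  | TraceModel => \sum_l f l
  end.

Lemma sqrt_powR (x : R) : 0 < x -> Num.sqrt x `^ q = x `^ (q / 2).
Proof. by move=> x0; rewrite -powR12_sqrt ?ltW// -powRrM mulrC. Qed.

Lemma exists_max f : exists l0, forall l, f l <= f l0.
Proof.
exists [arg max_(l > Ordinal m0) f l]%O.
by case: arg_maxP => // l0 _ fl0 l; exact: fl0.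
Qed.

(** Positivity keeps the default value 0 of the maximum from interfering; [0 < m] supplies an
    index. *)
Lemma bigmax_attained f : (forall l, 0 < f l) ->
  exists2 l0, forall l, f l <= f l0 & \big[Num.max/0]_l f l = f l0.
Proof.
move=> f0; have [l0 fl0] := exists_max f; exists l0 => //.
apply/eqP; rewrite eq_le le_bigmax andbT.
by apply: bigmax_le => // ; rewrite ltW.
Qed.

Lemma error_pow_aggregate f : (forall l, 0 < f l) ->
  error_pow em q (diag_mx (\row_l Num.sqrt (f l))) =
  aggregate (fun l => f l `^ (q / 2)).
Proof.
move=> f0; rewrite /error_pow /aggregate; case: em; last first.
  rewrite /diag_mx_powR /mxtrace; apply: eq_bigr => l _.
  by rewrite !mxE !eqxx !mulr1n sqrt_powR.
congr (_ * _); have [l0 fl0] := exists_max f.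
have q20 : 0 < q / 2 by rewrite divr_gt0.
rewrite (@spectral_norm_diag _ _ _ l0) => [|l]; last first.
  by rewrite !mxE sqrtr_ge0 ler_wsqrtr.
rewrite mxE sqrt_powR//; apply/eqP; rewrite eq_le.
rewrite (le_bigmax _ (fun l => f l `^ (q / 2)))/=.
apply: bigmax_le => [|l _]; first exact: powR_ge0.
by apply: ge0_ler_powR; rewrite ?nnegrE ?(ltW (f0 _)) ?(ltW q20).
Qed.

Let spectral_const_gt0 : 0 < (m%:R * (1 - 2 / (9 * m%:R)) ^+ 3) `^ (q / 2).
Proof.
(* For m >= 1 one has 2 < 9 m, so the base of the power is positive. *)
have m1 : 1 <= m%:R :> R by rewrite ler1n.
have m_gt0 : 0 < m%:R :> R by rewrite ltr0n.
apply: powR_gt0; rewrite mulr_gt0// exprn_gt0// subr_gt0.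
rewrite ltr_pdivrMr ?mulr_gt0// mul1r; lra.
Qed.

Lemma aggregate_gt0 f : (forall l, 0 < f l) -> 0 < aggregate f.
Proof.
move=> f0; rewrite /aggregate; case: em.
  have [l0 _ ->] := bigmax_attained f0.
  by rewrite mulr_gt0.
rewrite (bigD1 (Ordinal m0))//= ltr_pwDl//.
by apply: sumr_ge0 => l _; rewrite ltW.
Qed.

(** Treats both error models at once: sums are linear, and for the maximum the hypothesis is used at
    the index where [f] is largest. *)
Lemma aggregate_sublinear (a b : R) f g h : 0 <= a -> 0 <= b ->
  (forall l, 0 < f l) -> (forall l, f l <= a * g l + b * h l) ->
  aggregate f <= a * aggregate g + b * aggregate h.
Proof.
move=> a0 b0 f0 fgh; rewrite /aggregate; case: em; last first.
  by rewrite !mulr_sumr -big_split/=; apply: ler_sum.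
have [l0 _ ->] := bigmax_attained f0.
rewrite (mulrCA a) (mulrCA b) -mulrDr ler_pM2l//; apply: le_trans (fgh l0) _.
by rewrite lerD// ler_wpM2l//; exact: le_bigmax.
Qed.

Lemma aggregate_strictly_sublinear (a b : R) f g h : 0 <= a -> 0 <= b ->
  (forall l, 0 < f l) -> (forall l, f l < a * g l + b * h l) ->
  aggregate f < a * aggregate g + b * aggregate h.
Proof.
move=> a0 b0 f0 fgh; rewrite /aggregate; case: em; last first.
  rewrite !mulr_sumr -big_split/=; apply: ltr_sum => //.
  by apply/hasP; exists (Ordinal m0); rewrite ?mem_index_enum.
have [l0 _ ->] := bigmax_attained f0.
rewrite (mulrCA a) (mulrCA b) -mulrDr ltr_pM2l//; apply: lt_le_trans (fgh l0) _.
by rewrite lerD// ler_wpM2l//; exact: le_bigmax.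
Qed.

Lemma lt_aggregate f g : (forall l, 0 < f l) -> (forall l, f l < g l) ->
  aggregate f < aggregate g.
Proof.
(* Monotonicity is the sublinear bound with coefficients 1 and 0, the second function being 0. *)
move=> f0 fg; rewrite -[ltRHS]mul1r -[ltRHS]addr0.
rewrite -[X in _ + X](mul0r (aggregate (fun=> 0))).
by apply: aggregate_strictly_sublinear => // l; rewrite mul0r mul1r addr0.
Qed.

Lemma le_aggregate f g : (forall l, 0 < f l) -> (forall l, f l <= g l) ->
  aggregate f <= aggregate g.
Proof.
move=> f0 fg; rewrite -[leRHS]mul1r -[leRHS]addr0.
rewrite -[X in _ + X](mul0r (aggregate (fun=> 0))).
by apply: aggregate_sublinear => // l; rewrite mul0r mul1r addr0.
Qed.

Lemma aggregate_continuous (T : topologicalType) (F : 'I_m -> T -> R) :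
  (forall l, continuous (F l)) -> continuous (fun p => aggregate (F^~ p)).
Proof.
move=> cF; rewrite /aggregate; case: em; last exact: continuous_sum.
apply: continuous_mul; first exact: cst_continuous.
exact: continuous_bigmax.
Qed.

End error_aggregate.

(** * The pointwise error: positivity, continuity, bounds and log-convexity *)

Section integrand.
Variables (R : realType) (d m N : nat) (em : error_model) (q : R).
Variables (k : 'I_m -> 'rV[R]_d -> 'rV[R]_d -> R) (P : 'I_N -> 'rV[R]_d).
Hypotheses (m0 : (0 < m)%N) (q0 : 0 < q) (Pinj : injective P).
Hypothesis kcov : forall l, covariance_kernel (k l).
Implicit Types (v : 'rV[R]_N) (p : 'rV[R]_d).

Definition error_q v p : R := error_pow em q (posterior_sd_mx k P v p).

Lemma error_qE v p : nonneg_orthant v -> error_q v p =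
  aggregate em q (fun l => posterior_variance (k l) P v p `^ (q / 2)).
Proof.
move=> v0; rewrite /error_q /posterior_sd_mx error_pow_aggregate// => l.
exact: posterior_variance_gt0.
Qed.

Let q20 : 0 < q / 2. Proof. by rewrite divr_gt0. Qed.

Let sd_gt0 l v p : nonneg_orthant v ->
  0 < posterior_variance (k l) P v p `^ (q / 2).
Proof. by move=> v0; rewrite powR_gt0// posterior_variance_gt0. Qed.

Lemma error_q_gt0 v p : nonneg_orthant v -> 0 < error_q v p.
Proof.
by move=> v0; rewrite error_qE// aggregate_gt0// => l; exact: sd_gt0.
Qed.

Lemma error_q_continuous v : nonneg_orthant v -> continuous (error_q v).
Proof.
move=> v0; rewrite (_ : error_q v = (fun p =>
  aggregate em q (fun l => posterior_variance (k l) P v p `^ (q / 2)))).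
  apply: (@aggregate_continuous _ _ _ _ _
    (fun l p => posterior_variance (k l) P v p `^ (q / 2))) => l.
  apply: continuous_powR_comp; first exact: posterior_variance_continuous.
  by move=> p; exact: posterior_variance_gt0.
by apply/funext => p; rewrite error_qE.
Qed.

(** The prior variance dominates and is independent of p by translation invariance, so the bound is
    uniform in p, as integrability over a set of finite measure requires. *)
Lemma error_q_bounded v p : nonneg_orthant v ->
  error_q v p <= aggregate em q (fun l => k l 0 0 `^ (q / 2)).
Proof.
move=> v0; rewrite error_qE//; apply: le_aggregate => // l; first exact: sd_gt0.
have pv0 := posterior_variance_gt0 (kcov l) Pinj p v0.
have pvk := posterior_variance_le_prior (kcov l) Pinj p v0.
by rewrite -(kernel_diag (kcov l) p); exact: le_powR_gt0.
Qed.

Lemma error_q_lt v v' p : nonneg_orthant v ->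
  (forall i, v ord0 i < v' ord0 i) -> (forall l, cross_cov (k l) P p != 0) ->
  error_q v' p < error_q v p.
Proof.
move=> v0 vv' c0; have v'0 : nonneg_orthant v'.
  by move=> i; apply/ltW/(le_lt_trans _ (vv' i)); exact: v0.
rewrite !error_qE//; apply: lt_aggregate => // l; first exact: sd_gt0.
have pv'0 := posterior_variance_gt0 (kcov l) Pinj p v'0.
by apply: (lt_powR_gt0 q20 pv'0); exact: posterior_variance_lt.
Qed.

Section log_convexity.
Variables (t : R) (v1 v2 : 'rV[R]_N) (a b : R).
Hypotheses (v10 : nonneg_orthant v1) (v20 : nonneg_orthant v2).
Hypotheses (a0 : 0 < a) (b0 : 0 < b) (gab : gmean t a b = 1).

(* Log-convexity in v, linearized by the weighted AM-GM inequality so that it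
   passes to sums, maxima and integrals. *)
Lemma error_q_logconvex p : 0 <= t <= 1 ->
  error_q (t *: v1 + (1 - t) *: v2) p <=
  t * a * error_q v1 p + (1 - t) * b * error_q v2 p.
Proof.
move=> t01; have v0 := nonneg_orthant_conv v10 v20 t01.
have /andP[t0 t1] := t01.
rewrite !error_qE//; apply: aggregate_sublinear => //.
- by rewrite mulr_ge0// ltW.
- by rewrite mulr_ge0 ?subr_ge0// ltW.
- by move=> l; exact: sd_gt0.
move=> l; have S1 := posterior_variance_gt0 (kcov l) Pinj p v10.
have S2 := posterior_variance_gt0 (kcov l) Pinj p v20.
have S0 := posterior_variance_gt0 (kcov l) Pinj p v0.
rewrite -!mulrA.
(* AM-GM is applied to the terms scaled by [a] and [b]; the scaling disappears from the geometric
   mean because [gmean t a b] is 1. *)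
apply: le_trans (@gmean_le_amean _ t (a * _) (b * _) t01 _ _); last 2 first.
- by rewrite mulr_gt0// powR_gt0.
- by rewrite mulr_gt0// powR_gt0.
rewrite gmeanM ?powR_gt0// gab mul1r gmean_powR//.
apply: (le_powR_gt0 q20 S0); exact: posterior_variance_logconvex.
Qed.

(** Strictness comes from the posterior variance of each component; AM-GM is used only in its weak
    form, as the two scaled terms may coincide. *)
Lemma error_q_strictly_logconvex i : 0 < t < 1 -> v1 ord0 i != v2 ord0 i ->
  error_q (t *: v1 + (1 - t) *: v2) (P i) <
  t * a * error_q v1 (P i) + (1 - t) * b * error_q v2 (P i).
Proof.
move=> t01 v12; have t01' : 0 <= t <= 1.
  by case/andP: t01 => *; apply/andP; split; apply: ltW.
have v0 := nonneg_orthant_conv v10 v20 t01'.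
have /andP[t0 t1] := t01'.
rewrite !error_qE//; apply: aggregate_strictly_sublinear => //.
- by rewrite mulr_ge0// ltW.
- by rewrite mulr_ge0 ?subr_ge0// ltW.
- by move=> l; exact: sd_gt0.
move=> l; have S1 := posterior_variance_gt0 (kcov l) Pinj (P i) v10.
have S2 := posterior_variance_gt0 (kcov l) Pinj (P i) v20.
have S0 := posterior_variance_gt0 (kcov l) Pinj (P i) v0.
rewrite -!mulrA.
apply: lt_le_trans (@gmean_le_amean _ t (a * _) (b * _) t01' _ _); last 2 first.
- by rewrite mulr_gt0// powR_gt0.
- by rewrite mulr_gt0// powR_gt0.
rewrite gmeanM ?powR_gt0// gab mul1r gmean_powR//.
apply: (lt_powR_gt0 q20 S0); exact: posterior_variance_strictly_logconvex.
Qed.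

End log_convexity.

End integrand.

(** * Lebesgue measure on R^d *)

Section lebesgue_rV_theory.
Variables (R : realType) (d : nat).
Implicit Types (U X : set 'rV[R]_d) (p : 'rV[R]_d).

Lemma measurable_rV_box (A : 'I_d -> set R) : (forall i, measurable (A i)) ->
  measurable [set x : 'rV[R]_d | forall i, A i (x ord0 i)].
Proof.
move=> mA; rewrite (_ : mkset _ = \bigcap_(i in [set: 'I_d])
    ((fun x : 'rV[R]_d => x ord0 i) @^-1` A i)); last first.
  by apply/seteqP; split => [x Ax i _|x Ax i]; exact: Ax.
apply: fin_bigcap_measurable => // i _.
by rewrite -[X in measurable X]setTI; exact: measurable_rV_coor.
Qed.

(** The sigma-algebra is generated by coordinates, so U is written as the countable union of the
    boxes inside it with rational centres and radii 1/(n+1). *)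
Lemma open_measurable_rV U : open U -> measurable U.
Proof.
move=> oU.
pose box (z : 'rV[rat]_d * nat) : set 'rV[R]_d :=
  [set x | forall i, ball (ratr (z.1 ord0 i) : R) z.2.+1%:R^-1 (x ord0 i)].
have mbox z : measurable (box z).
  apply: (@measurable_rV_box
    (fun i => ball (ratr (z.1 ord0 i) : R) z.2.+1%:R^-1)).
  by move=> i; apply: open_measurable; exact: ball_open.
rewrite (_ : U = \bigcup_z (if `[< box z `<=` U >] then box z else set0)).
  apply: countable_bigcupT_measurable => // z.
  by case: asboolP => _; [exact: mbox|exact: measurable0].
apply/seteqP; split => [x Ux|x [z _]]; last by case: asboolP => // zU /zU.
have /nbhs_ballP[e /= e0 eU] : nbhs x U by exact: open_nbhs_nbhs.
(* With the radius below e/2, a box whose centre is within that radius of x stays inside the e-ball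
   around x. *)
have [n _ /(_ n (leqnn _)) /= ne] :=
  near_infty_natSinv_lt (PosNum (divr_gt0 e0 (ltr0n R 2))).
have n0 : 0 < n.+1%:R^-1 :> R by rewrite invr_gt0.
have xr (i : 'I_d) : exists r : rat, `|ratr r - x ord0 i| < n.+1%:R^-1.
  have [|r] := @rat_in_itvoo R (x ord0 i) (x ord0 i + n.+1%:R^-1).
    by rewrite ltrDl.
  rewrite in_itv/= => /andP[xr rx]; exists r.
  by rewrite ger0_norm ?subr_ge0 1?ltW// ltrBlDl.
have [r xr'] := choice xr.
exists (\row_i r i, n) => //.
have bU : box (\row_i r i, n) `<=` U.
  move=> y by_; apply: eU; split => // a i; rewrite ord1.
  have := by_ i; rewrite /= mxE /ball/= => yr.
  have -> : x ord0 i - y ord0 i =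
      (x ord0 i - ratr (r i)) + (ratr (r i) - y ord0 i).
    by rewrite addrA subrK.
  rewrite (splitr e); apply: le_lt_trans (ler_normD _ _) _.
  apply: ltrD; first by rewrite distrC (lt_trans (xr' i)).
  by rewrite (lt_trans yr).
by case: asboolP => // _ i; rewrite /= mxE; exact: xr'.
Qed.

Lemma closed_measurable_rV X : closed X -> measurable X.
Proof.
by move=> cX; rewrite -[X]setCK; apply: measurableC; apply: open_measurable_rV;
  exact: closed_openC.
Qed.

Lemma continuous_measurable_fun_rV (f : 'rV[R]_d -> R) :
  continuous f -> measurable_fun setT f.
Proof.
move=> /continuousP cf; apply: (measurability _ (RGenOpens.measurableE R)).
move=> _ [_ [a [b ->] <-]]; rewrite setTI; apply: open_measurable_rV.
exact/cf/interval_open.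
Qed.

Lemma bounded_lebesgue_rV_lty X : measurable X -> bounded_set X ->
  (lebesgue_rV d X < +oo)%E.
Proof.
move=> mX [M0 [_ /(_ (M0 + 1) (ltr_pwDr ltr01 (lexx _)))]].
set M := M0 + 1 => XM.
pose A (i : 'I_d) : set R := [set` `[- M, M]].
have mA i : measurable (A i) by exact: measurable_itv.
apply: (@le_lt_trans _ _ (lebesgue_rV d [set x | forall i, A i (x ord0 i)])).
  apply: le_measure; rewrite ?inE//; first exact: measurable_rV_box.
  move=> x /XM /= xM i; rewrite /A/= in_itv/= -ler_norml.
  apply: le_trans xM; rewrite [leRHS]/Num.norm/= mx_normrE.
  exact: (le_bigmax _ (fun ij => `|x ij.1 ij.2|) (ord0, i)).
rewrite lebesgue_rV_box// ltey_eq; apply/orP; left.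
apply: (@big_ind _ (fun x : \bar R => x \is a fin_num)) => // [x y|i _].
  exact: fin_numM.
by rewrite lebesgue_measure_itv/=; case: ifP.
Qed.

End lebesgue_rV_theory.

(** * Linearity and strict monotonicity of real-valued integrals *)

Section Rintegral_theory.
Context dT (T : measurableType dT) (R : realType).
Variable mu : {measure set T -> \bar R}.

Lemma integrable_lincomb (D : set T) (f g : T -> R) (a b : R) :
  measurable D ->
  mu.-integrable D (EFin \o f) -> mu.-integrable D (EFin \o g) ->
  mu.-integrable D (EFin \o (fun x => a * f x + b * g x)).
Proof.
move=> mD intf intg.
exact: (integrableD mD (integrableZl mD a intf) (integrableZl mD b intg)).
Qed.

Lemma Rintegral_lincomb (D : set T) (f g : T -> R) (a b : R) :
  measurable D ->
  mu.-integrable D (EFin \o f) -> mu.-integrable D (EFin \o g) ->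
  \int[mu]_(x in D) (a * f x + b * g x) =
  a * \int[mu]_(x in D) f x + b * \int[mu]_(x in D) g x.
Proof.
move=> mD intf intg; rewrite RintegralD//; last 2 first.
- exact: (integrableZl mD a intf).
- exact: (integrableZl mD b intg).
by rewrite !RintegralZl.
Qed.

(** If the integrals were equal, the nonnegative difference g - f would vanish almost everywhere,
    yet it is positive on A, which has positive measure. *)
Lemma lt_Rintegral (D A : set T) (f g : T -> R) :
  measurable D ->
  mu.-integrable D (EFin \o f) -> mu.-integrable D (EFin \o g) ->
  (forall x, D x -> f x <= g x) ->
  A `<=` D -> measurable A -> (0 < mu A)%E -> (forall x, A x -> f x < g x) ->
  \int[mu]_(x in D) f x < \int[mu]_(x in D) g x.
Proof.
move=> mD intf intg fg AD mA A0 Afg.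
rewrite lt_neqAle le_Rintegral// andbT; apply/negP => /eqP efg.
have inth : mu.-integrable D (EFin \o (fun x => g x - f x)).
  rewrite (_ : _ \o _ = ((EFin \o g) \- (EFin \o f))%E).
    exact: integrableB.
  by apply/funext => x; rewrite /= EFinB.
have h0 : (\int[mu]_(x in D) `|(g x - f x)%:E| = 0)%E.
  rewrite (eq_integral (fun x => (g x - f x)%:E)); last first.
    by move=> x; rewrite inE => Dx; rewrite gee0_abs// lee_fin subr_ge0 fg.
  have := RintegralB mD intg intf; rewrite efg subrr /Rintegral => e.
  by rewrite -[LHS]fineK ?e//; exact: integrable_fin_num.
have mh : measurable_fun D (fun x => (g x - f x)%:E) by case/integrableP: inth.
have [N [mN N0 DN]] := (ae_eq_integral_abs mu mD mh).1 h0.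
have : (mu A <= mu N)%E.
  apply: le_measure; rewrite ?inE// => x Ax; apply: DN => /= /(_ (AD _ Ax)).
  by move=> [] /eqP; rewrite gt_eqF// subr_gt0 Afg.
by rewrite N0 leNgt A0.
Qed.

End Rintegral_theory.

(** * Objective and work constraint *)

Lemma powRD_near0 (R : realType) (s x e : R) : 0 < s -> 0 <= x -> 0 < e ->
  \forall dl \near 0^'+, (x + dl) `^ s < x `^ s + e.
Proof.
move=> s0 x0 e0; have xe : x `^ s < x `^ s + e by rewrite ltrDl.
have cv : (x + dl) `^ s @[dl --> 0^'+] --> x `^ s.
  (* At x = 0 the power need not be differentiable, so its right limit there is taken separately;
     for x > 0 continuity follows from differentiability. *)
  move: x0; rewrite le_eqVlt => /predU1P[<-|x0].
    rewrite powR0 ?gt_eqF//.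
    under eq_cvg do rewrite add0r.
    exact: powR_cvg0.
  have cp : {for x, continuous (fun a => a `^ s)}.
    apply: (@differentiable_continuous R R^o R^o); apply/derivable1_diffP.
    by apply: derivable_powR; rewrite in_itv/= x0.
  have xdl : (x + dl) @[dl --> (0 : R)^'+] --> x + 0.
    apply: cvgD; first exact: cvg_cst.
    exact: cvg_at_right_filter cvg_id.
  by rewrite addr0 in xdl; exact: (cvg_comp _ _ xdl cp).
exact: (cvgr_lt _ cv).
Qed.

Lemma work_perturb (R : realType) (N : nat) (s b : R) (v : 'rV[R]_N) :
  0 < s -> nonneg_orthant v -> work s v < b ->
  exists2 dl : R, 0 < dl & work s (v + const_mx dl) <= b.
Proof.
(* The slack is shared equally among the N coordinates; dividing by N + 1 keeps the quotient
   meaningful for N = 0. *)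
move=> s0 v0 vb; pose e : R := (b - work s v) / N.+1%:R.
have e0 : 0 < e by rewrite divr_gt0 ?subr_gt0.
have nr i : \forall dl \near 0^'+, (v ord0 i + dl) `^ s < v ord0 i `^ s + e.
  by apply: powRD_near0 => //; exact: v0.
have [dl [dl0 dlP]] : exists dl : R, 0 < dl /\
    forall i, (v ord0 i + dl) `^ s < v ord0 i `^ s + e.
  apply: (@filter_ex _ (0^'+ : set_system R)); near=> dl; split => //.
  by near: dl; exact: filter_forall.
exists dl => //; apply: (@le_trans _ _ (\sum_i (v ord0 i `^ s + e))).
  by apply: ler_sum => i _; rewrite !mxE ltW.
rewrite big_split/= sumr_const card_ord -/(work s v) -lerBrDl.
rewrite -[leLHS]mulr_natr /e -mulrA ler_piMr ?subr_ge0 ?(ltW vb)//.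
by rewrite mulrC ler_pdivrMr ?ltr0n// mul1r ler_nat.
Unshelve. all: by end_near. Qed.

Section objective.
Variables (R : realType) (d m N : nat) (X : set 'rV[R]_d).
Variables (P : 'I_N -> 'rV[R]_d) (k : 'I_m -> 'rV[R]_d -> 'rV[R]_d -> R).
Variables (w : 'rV[R]_d -> R) (em : error_model) (q : R).
Hypotheses (m0 : (0 < m)%N) (Xclosed : closed X) (Xbounded : bounded_set X).
Hypotheses (X0 : (0 < lebesgue_rV d X)%E) (Pinj : injective P).
Hypothesis kcov : forall l, covariance_kernel (k l).
Hypotheses (mw : measurable_fun X w) (wbounded : [bounded w p | p in X]).
Hypotheses (w0 : forall p, X p -> 0 < w p) (q0 : 0 < q).
Implicit Types v : 'rV[R]_N.

Let mX : measurable X := closed_measurable_rV Xclosed.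

Let f v p := w p `^ q * error_q em q k P v p.

Let F v := \int[lebesgue_rV d]_(p in X) f v p.

Let f_gt0 v p : nonneg_orthant v -> X p -> 0 < f v p.
Proof. by move=> v0 Xp; rewrite mulr_gt0 ?powR_gt0 ?w0// error_q_gt0. Qed.

Lemma integrand_integrable v : nonneg_orthant v ->
  (lebesgue_rV d).-integrable X (EFin \o f v).
Proof.
move=> v0; apply: measurable_bounded_integrable => //.
- exact: bounded_lebesgue_rV_lty.
- apply: measurable_funM.
    exact: (measurableT_comp (measurable_powR q) mw).
  apply: measurable_funTS; apply: continuous_measurable_fun_rV.
  exact: error_q_continuous.
have [M0 [_ /(_ (M0 + 1) (ltr_pwDr ltr01 (lexx _)))]] := wbounded.
set M := M0 + 1 => wM.
pose C := aggregate em q (fun l => k l 0 0 `^ (q / 2)).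
exists (M `^ q * C); split; first exact: num_real.
move=> B CB p Xp /=; apply: le_trans (ltW CB).
rewrite (ger0_norm (ltW (f_gt0 v0 Xp))); apply: ler_pM.
- exact: powR_ge0.
- by rewrite ltW// error_q_gt0.
- have wpM : w p <= M by apply: le_trans (wM _ Xp); exact: ler_norm.
  apply: ge0_ler_powR; rewrite ?nnegrE ?(ltW q0) ?(ltW (w0 Xp))//.
  exact: le_trans (ltW (w0 Xp)) wpM.
- exact: error_q_bounded.
Qed.

Let F_gt0 v : nonneg_orthant v -> 0 < F v.
Proof.
(* Zero is written as the integral of the zero function, so that strict monotonicity applies on all
   of X. *)
move=> v0; rewrite -(mul0r (fine (lebesgue_rV d X))) -Rintegral_cst//.
apply: (@lt_Rintegral _ _ _ _ X X) => //.
- exact: integrable0.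
- exact: integrand_integrable.
- by move=> p Xp; rewrite ltW// f_gt0.
- by move=> p Xp; exact: f_gt0.
Qed.

Let E := error_objective em X w q k P.

Let EE v : E v = F v `^ q^-1. Proof. by []. Qed.

Let qV0 : 0 < q^-1. Proof. by rewrite invr_gt0. Qed.

Let E_gt0 v : nonneg_orthant v -> 0 < E v.
Proof. by move=> v0; apply: powR_gt0; exact: F_gt0. Qed.

Lemma error_objective_lt v v' : nonneg_orthant v ->
  (forall i, v ord0 i < v' ord0 i) ->
  (forall l p, cross_cov (k l) P p != 0) -> E v' < E v.
Proof.
move=> v0 vv' c0; have v'0 : nonneg_orthant v'.
  by move=> i; apply/ltW/(le_lt_trans _ (vv' i)); exact: v0.
have ff' p : X p -> f v' p < f v p.
  move=> Xp; rewrite ltr_pM2l ?powR_gt0 ?w0//.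
  by apply: error_q_lt => // l; exact: c0.
have F'F : F v' < F v.
  apply: (@lt_Rintegral _ _ _ _ X X _ _ mX (integrand_integrable v'0)
    (integrand_integrable v0) _ (fun _ => id) mX X0 ff').
  by move=> p /ff'/ltW.
by rewrite !EE; exact: (lt_powR_gt0 qV0 (F_gt0 v'0) F'F).
Qed.

Section convexity.
Variables (t : R) (v1 v2 : 'rV[R]_N).
Hypotheses (v10 : nonneg_orthant v1) (v20 : nonneg_orthant v2).

(** The weights [a] and [b] are those of [gmean_weights]: with them the pointwise upper bound
    integrates exactly to G, which replaces an appeal to Hoelder's inequality. *)
Let G := gmean t (F v1) (F v2).

Let a := G / F v1.

Let b := G / F v2.

Let G_gt0 : 0 < G. Proof. exact: gmean_gt0 (F_gt0 v10) (F_gt0 v20). Qed.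

Let a_gt0 : 0 < a. Proof. exact: divr_gt0 G_gt0 (F_gt0 v10). Qed.

Let b_gt0 : 0 < b. Proof. exact: divr_gt0 G_gt0 (F_gt0 v20). Qed.

Let gab : gmean t a b = 1.
Proof. exact: gmean_weights (F_gt0 v10) (F_gt0 v20). Qed.

Let upper p := t * a * f v1 p + (1 - t) * b * f v2 p.

Let upper_integrable : (lebesgue_rV d).-integrable X (EFin \o upper).
Proof.
exact: (integrable_lincomb _ _ mX (integrand_integrable v10)
  (integrand_integrable v20)).
Qed.

Let int_upper : \int[lebesgue_rV d]_(p in X) upper p = G.
Proof.
have i1 := integrand_integrable v10; have i2 := integrand_integrable v20.
exact: etrans (Rintegral_lincomb _ _ mX i1 i2)
  (gmean_weights_amean _ (F_gt0 v10) (F_gt0 v20)).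
Qed.

Let upperE p : upper p = w p `^ q *
  (t * a * error_q em q k P v1 p + (1 - t) * b * error_q em q k P v2 p).
Proof.
have aux (W A B x y : R) : A * (W * x) + B * (W * y) = W * (A * x + B * y).
  by ring.
exact: aux.
Qed.

Let le_upper : 0 <= t <= 1 -> forall p, X p ->
  f (t *: v1 + (1 - t) *: v2) p <= upper p.
Proof.
move=> t01 p Xp; rewrite upperE ler_wpM2l ?powR_ge0//.
exact: (error_q_logconvex em m0 q0 Pinj kcov v10 v20 a_gt0 b_gt0 gab p t01).
Qed.

Let gmean_E : G `^ q^-1 = gmean t (E v1) (E v2).
Proof. by rewrite !EE (gmean_powR _ _ (F_gt0 v10) (F_gt0 v20)). Qed.

(** Integrating the pointwise bound gives F <= G at the intermediate point. The q-th root commutes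
    with the geometric mean, so E is log-convex, and AM-GM concludes. *)
Lemma error_objective_convex : 0 <= t <= 1 ->
  E (t *: v1 + (1 - t) *: v2) <= t * E v1 + (1 - t) * E v2.
Proof.
move=> t01; have v0 := nonneg_orthant_conv v10 v20 t01.
apply: le_trans (gmean_le_amean t01 (E_gt0 v10) (E_gt0 v20)).
rewrite -gmean_E EE; apply: (le_powR_gt0 qV0 (F_gt0 v0)).
rewrite -int_upper.
exact: (le_Rintegral mX (integrand_integrable v0) upper_integrable
  (le_upper t01)).
Qed.

Lemma error_objective_strictly_convex :
  (forall i, in_lebesgue_support X (P i)) -> 0 < t < 1 -> v1 != v2 ->
  E (t *: v1 + (1 - t) *: v2) < t * E v1 + (1 - t) * E v2.
Proof.
move=> Psupp t01 v12; have t01' : 0 <= t <= 1.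
  by case/andP: t01 => *; apply/andP; split; apply: ltW.
have v0 := nonneg_orthant_conv v10 v20 t01'.
apply: lt_le_trans (gmean_le_amean t01' (E_gt0 v10) (E_gt0 v20)).
have [i vi] : exists i, v1 ord0 i != v2 ord0 i.
  apply/existsP; apply: contraNT v12; rewrite negb_exists => /forallP e.
  by apply/eqP/rowP => i; apply/eqP; have := e i; rewrite negbK.
rewrite -gmean_E EE; apply: (lt_powR_gt0 qV0 (F_gt0 v0)).
rewrite -int_upper.
(* The gap is taken without the weight [w], which is only measurable: [h] is continuous, so its
   positivity at P i spreads to an open set. *)
pose h p := t * a * error_q em q k P v1 p + (1 - t) * b * error_q em q k P v2 p
  + (-1) * error_q em q k P (t *: v1 + (1 - t) *: v2) p.
have ch : continuous h.
  have cs c v : nonneg_orthant v ->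
      continuous (fun p => c * error_q em q k P v p).
    move=> vv; apply: continuous_mul; first exact: cst_continuous.
    exact: error_q_continuous.
  by apply: continuous_add; [apply: continuous_add|]; exact: cs.
have hi : 0 < h (P i).
  rewrite /h mulN1r subr_gt0.
  exact: (error_q_strictly_logconvex em m0 q0 Pinj kcov v10 v20
    a_gt0 b_gt0 gab).
have oU : open [set p | 0 < h p].
  apply: (@open_comp _ _ h [set x | 0 < x]) => [p _|]; first exact: ch.
  exact: open_gt.
apply: (@lt_Rintegral _ _ _ _ X (X `&` [set p | 0 < h p]) _ _ mX
  (integrand_integrable v0) upper_integrable (le_upper t01')).
- exact: subIsetl.
- by apply: measurableI => //; exact: open_measurable_rV.
- exact: (Psupp i _ oU hi).
move=> p [Xp /=]; rewrite /h mulN1r subr_gt0 upperE => hp.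
by rewrite ltr_pM2l// powR_gt0// w0.
Qed.

End convexity.

End objective.

Theorem theorem3p2 (R : realType) (d m n j : nat)
    (X : set 'rV[R]_d) (P : 'I_(n + j) -> 'rV[R]_d) (eps : 'I_n -> R)
    (k : 'I_m -> 'rV[R]_d -> 'rV[R]_d -> R) (w : 'rV[R]_d -> R)
    (em : error_model) (q s dW : R) :
  (0 < m)%N -> (0 < n + j)%N ->
  closed X -> bounded_set X -> (0 < lebesgue_rV d X)%E ->
  injective P -> (forall i, X (P i)) ->
  (forall i, 0 < eps i) ->
  (forall l, covariance_kernel (k l)) ->
  measurable_fun X w -> [bounded w p | p in X] -> (forall p, X p -> 0 < w p) ->
  2 <= q -> 0 < s -> 0 < dW ->
  let E := error_objective em X w q k P in
  convex_function (@nonneg_orthant R (n + j)) E /\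
  ((forall l, strictly_positive_kernel (k l)) ->
   ((forall i, in_lebesgue_support X (P i)) ->
    strictly_convex_function (@nonneg_orthant R (n + j)) E) /\
   (forall v, is_minimizer (@feasible R n j s dW eps) E v ->
      work s v = dW + design_work s eps)).
Proof.
move=> m0 nj0 Xcl Xbd X0 Pinj _ _ kcov mw wbd w0 q2 s0 _ E.
have q0 : 0 < q by rewrite (lt_le_trans _ q2).
split.
  move=> t v1 v2 /set_mem v10 /set_mem v20.
  apply: (@error_objective_convex R d m (n + j) X P k w em q) => //.
  exact/andP.
move=> kpos; split=> [Psupp t t01 v1 v2 /set_mem v10 /set_mem v20 v12|].
  exact: (@error_objective_strictly_convex R d m (n + j) X P k w em q).
move=> v [[v0 vW vlb] vmin]; apply/eqP; rewrite eq_le vW leNgt/=.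
(* With budget left, all coordinates can be raised by a common [dl] while staying feasible, which
   would strictly lower E. *)
apply/negP => /(work_perturb s0 v0)[dl dl0 dlW].
have vv' i : v ord0 i < (v + const_mx dl) ord0 i by rewrite !mxE ltrDl.
have : E v <= E (v + const_mx dl).
  apply: vmin; split => // i; last by rewrite (le_trans (vlb i))// ltW.
  by rewrite (le_trans (v0 i))// ltW.
rewrite leNgt => /negP; apply; apply: error_objective_lt => // l p.
(* Strict positivity of the kernel makes the entry of the cross-covariance at the first point
   nonzero; [nj0] ensures that such a point exists. *)
apply/eqP => /colP/(_ (Ordinal nj0)); rewrite !mxE => /eqP.
by rewrite gt_eqF// kpos.
Qed.
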